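(* Let $\Lambda=\Lambda_0\oplus\Lambda_1$ be a finite-dimensional commutative superalgebra satisfying conditions $(A_0)$ and $(A_1)$, with bases $(e_0=1,e_1,\dots,e_p)$ of $\Lambda_0$ and $(\varepsilon_1,\dots,\varepsilon_q)$ of $\Lambda_1$, integers $1=s_1<\dots<s_r<s_{r+1}=q+1$ and elements $a_1,\dots,a_q\in\Lambda_0$ as in these conditions. Let $n,m$ be non-negative integers and put $N=n(p+1)+mq$, assumed $\ge 1$. On $\mathbb{R}^{n,m}_\Lambda=\Lambda_0^n\times\Lambda_1^m\cong\mathbb{R}^N$ consider the $\Lambda$-valued $(N-1)$-form $$\Omega=\frac{c}{\|x\|^{N}}\Big[\sum_{i=1}^{n}\sum_{j=1}^{p}(-1)^{(p+1)(i-1)+j}\,(y_i^j e_0+y_i^0 e_j)\,dy_1^0\wedge\cdots\wedge\widehat{dy_i^j}\wedge\cdots\wedge dy_n^p\wedge d\theta_1^1\wedge\cdots\wedge d\theta_m^q$$ $$\qquad+\sum_{l=1}^{m}\sum_{k=1}^{r}\sum_{i=s_k+1}^{s_{k+1}-1}(-1)^{n(p+1)+q(l-1)+i-1}\,(\theta_l^i e_0+\theta_l^{s_k}a_i)\,dy_1^0\wedge\cdots\wedge dy_n^p\wedge d\theta_1^1\wedge\cdots\wedge\widehat{d\theta_l^i}\wedge\cdots\wedge d\theta_m^q\Big],$$ where $\|x\|$ is the Euclidean norm of $x$ in the real coordinates $(y_i^j,\theta_l^k)$, a hat denotes an omitted factor, and $c=\dfrac{1}{N\,\mathrm{Vol}(B(0,1))}$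 with $B(0,1)$ the Euclidean unit ball of $\mathbb{R}^N$. Then $\Omega$ is a fundamental solution of the Cauchy-Riemann operator $d''$ on $\mathbb{R}^{n,m}_\Lambda$, that is, $d''\Omega=[0]$ in the sense of currents, where $[0]=\delta_0\,dy_1^0\wedge\cdots\wedge dy_n^p\wedge d\theta_1^1\wedge\cdots\wedge d\theta_m^q$ is the current of integration (evaluation) at the origin.
   Context: A commutative superalgebra (CSA) is a real associative unital algebra $\Lambda=\Lambda_0\oplus\Lambda_1$ (direct sum of real vector subspaces), here always of finite dimension, such that $\Lambda_0$ is a subalgebra, $\Lambda_1\Lambda_1\subset\Lambda_0$, $\Lambda_0\Lambda_1\subset\Lambda_1$, elements of $\Lambda_0$ commute with all elements of $\Lambda$, and any two elements of $\Lambda_1$ anticommute. The unit is $e_0=1\in\Lambda_0$; $\dim\Lambda_0=p+1$, $\dim\Lambda_1=q$. Condition $(A_0)$: there is a basis $(e_0=1,e_1,\dots,e_p)$ of $\Lambda_0$ with $\sum_{k=0}^p e_k^2=0$. Condition $(A_1)$: there are a basis $(\varepsilon_1,\dots,\varepsilon_q)$ of $\Lambda_1$ and integers $s_1=1<s_2<\dots<s_r<s_{r+1}=q+1$ such that for every $j=1,\dots,q$ there is $a_j\in\Lambda_0$ with $\varepsilon_j=a_j\varepsilon_{s_k}$ whenever $s_k\le j<s_{k+1}$, with $a_{s_1}=\dots=a_{s_r}=e_0$ and $\sum_{j=s_k}^{s_{k+1}-1}a_j^2=0$ for every $k=1,\dots,r$. (Vacuous, with $r=0$, if $q=0$.) Points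 of $\mathbb{R}^{n,m}_\Lambda=\Lambda_0^n\times\Lambda_1^m$ are written $x=(y,\theta)=(y_1,\dots,y_n,\theta_1,\dots,\theta_m)$ with $y_i=\sum_{j=0}^p y_i^j e_j$ and $\theta_l=\sum_{k=1}^q\theta_l^k\varepsilon_k$, the $y_i^j,\theta_l^k$ being real coordinates; the coordinates are ordered $y_1^0,\dots,y_1^p,\dots,y_n^0,\dots,y_n^p,\theta_1^1,\dots,\theta_1^q,\dots,\theta_m^1,\dots,\theta_m^q$, which fixes the orientation. The Cauchy-Riemann operator is $$d''=\sum_{i=1}^n\sum_{j=1}^p dy_i^j\Big(\frac{\partial}{\partial y_i^j}-e_j\frac{\partial}{\partial y_i^0}\Big)+\sum_{l=1}^m\sum_{k=1}^r\sum_{i=s_k+1}^{s_{k+1}-1}d\theta_l^i\Big(\frac{\partial}{\partial\theta_l^i}-a_i\frac{\partial}{\partial\theta_l^{s_k}}\Big).$$ It acts on $\Lambda$-valued differential forms by applying the differential operators to the coefficients (multiplication by $e_j,a_i$ in $\Lambda$) and wedging with $dy_i^j$, $d\theta_l^i$ on the left; the real differentials commute with elements of $\Lambda$. On forms with locally integrable coefficients the derivatives are taken in the sense of distributions. *)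

(* Defs.v *)
From HB Require Import structures.
From mathcomp Require Import all_boot all_order all_algebra.
From mathcomp Require Import falgebra.
From mathcomp Require Import all_classical all_reals all_analysis.

Set Implicit Arguments.
Unset Strict Implicit.
Unset Printing Implicit Defensive.

Import Order.TTheory GRing.Theory Num.Theory.
Import numFieldNormedType.Exports.

Local Open Scope classical_set_scope.
Local Open Scope ring_scope.

(** All families are indexed from 0: [e`_0, ..., e`_p] is a basis of [L0] and
    [eps`_0, ..., eps`_q.-1] a basis of [L1].  The cut points
    1 = s_1 < ... < s_r < s_{r+1} = q+1 become 0 = s 0 < ... < s r = q (the other
    values of [s] are irrelevant), so that r = 0 if and only if q = 0. *)

Definition is_CSA (R : realType) (L : falgType R) (L0 L1 : {vspace L}) : Prop :=
  [/\ (L0 + L1)%VS = fullv /\ (L0 :&: L1)%VS = 0%VS,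
      1 \in L0 /\ (forall x y, x \in L0 -> y \in L0 -> x * y \in L0),
      (forall x y, x \in L1 -> y \in L1 -> x * y \in L0) /\
        (forall x y, x \in L0 -> y \in L1 -> x * y \in L1),
      forall x y, x \in L0 -> x * y = y * x &
      forall x y, x \in L1 -> y \in L1 -> x * y = - (y * x)].

Definition condA0 (R : realType) (L : falgType R) (L0 : {vspace L}) (p : nat)
    (e : p.+1.-tuple L) : Prop :=
  [/\ basis_of L0 e, e`_0 = 1 & \sum_(k < p.+1) e`_k ^+ 2 = 0].

Definition condA1 (R : realType) (L : falgType R) (L0 L1 : {vspace L})
    (q r : nat) (eps : q.-tuple L) (s : nat -> nat) (a : q.-tuple L) : Prop :=
  [/\ basis_of L1 eps,
      [/\ s 0%N = 0%N, s r = q & forall k, (k < r)%N -> (s k < s k.+1)%N],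
      forall j, (j < q)%N -> a`_j \in L0 &
      forall k, (k < r)%N ->
        [/\ a`_(s k) = 1,
            forall j, (s k <= j < s k.+1)%N -> eps`_j = a`_j * eps`_(s k) &
            \sum_(s k <= j < s k.+1) a`_j ^+ 2 = 0]].

Section LebesgueMeasure.
Context {R : realType}.
Local Notation mR := (measurableTypeR R).
Local Open Scope ereal_scope.

Definition tcons (n : nat) (z : mR * n.-tuple mR) : n.+1.-tuple mR :=
  [the n.+1.-tuple mR of z.1 :: z.2].

Lemma measurable_tcons n : measurable_fun [set: mR * n.-tuple mR] (@tcons n).
Proof. exact: measurable_cons. Qed.

(** The product of [lebesgue_measure] and [mu], transported to (n+1)-tuples. *)
Definition lebesgue_cons n
    (mu : {sigma_finite_measure set (n.-tuple mR) -> \bar R}) :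
    set (n.+1.-tuple mR) -> \bar R :=
  pushforward (lebesgue_measure \x mu) (@tcons n).

Section Instance.
Context n (mu : {sigma_finite_measure set (n.-tuple mR) -> \bar R}).

Let m0 : lebesgue_cons mu set0 = 0.
Proof. by rewrite /lebesgue_cons /pushforward preimage_set0 measure0. Qed.

Let m_ge0 A : 0 <= lebesgue_cons mu A.
Proof. by rewrite /lebesgue_cons /pushforward; exact: measure_ge0. Qed.

Let m_sigma_additive : semi_sigma_additive (lebesgue_cons mu).
Proof.
move=> F mF tF mUF; rewrite /lebesgue_cons /pushforward preimage_bigcup.
apply: measure_semi_sigma_additive.
- by move=> i; rewrite -[X in measurable X]setTI; exact: measurable_tcons.
- apply/trivIsetP => /= i j _ _ ij; rewrite -preimage_setI.
  by move/trivIsetP : tF => /(_ _ _ _ _ ij) ->//; rewrite preimage_set0.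
- by rewrite -preimage_bigcup -[X in measurable X]setTI; exact: measurable_tcons.
Qed.

HB.instance Definition _ :=
  isMeasure.Build _ _ _ (lebesgue_cons mu) m0 m_ge0 m_sigma_additive.

Let m_sigma_finite : sigma_finite setT (lebesgue_cons mu).
Proof.
have /sigma_finiteP[F [FT Fnd Foo]] := sigma_finiteT (@lebesgue_measure R).
have /sigma_finiteP[G [GT Gnd Goo]] := sigma_finiteT mu.
pose hd (t : n.+1.-tuple mR) : mR := thead t.
pose tl (t : n.+1.-tuple mR) : n.-tuple mR := [tuple of behead t].
have mhd : measurable_fun setT hd by exact: measurable_tnth.
have mtl : measurable_fun setT tl by exact: measurable_behead.
exists (fun i => hd @^-1` F i `&` tl @^-1` G i).
  apply/esym/seteqP; split => // t _.
  have [i _ Fi] : (\bigcup_i F i) (hd t) by rewrite -FT.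
  have [j _ Gj] : (\bigcup_i G i) (tl t) by rewrite -GT.
  exists (maxn i j) => //; split => /=.
    by move/subsetPset : (Fnd _ _ (leq_maxl i j)); apply.
  by move/subsetPset : (Gnd _ _ (leq_maxr i j)); apply.
move=> i; have [mF Fi] := Foo i; have [mG Gi] := Goo i; split.
  by apply: measurableI; rewrite -[X in measurable X]setTI;
    [exact: mhd|exact: mtl].
rewrite /lebesgue_cons /pushforward.
have -> : @tcons n @^-1` (hd @^-1` F i `&` tl @^-1` G i) = F i `*` G i.
  apply/seteqP; split => -[x t] /=; rewrite /hd /tl /thead /=.
    by move=> [? h]; split => //=; congr (G i _): h; exact: val_inj.
  by move=> [? h]; split => //=; congr (G i _): h; exact: val_inj.
by rewrite product_measure1E// lte_mul_pinfty// ge0_fin_numE.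
Qed.

HB.instance Definition _ := Measure_isSigmaFinite.Build _ _ _
  (lebesgue_cons mu) m_sigma_finite.

End Instance.

Fixpoint lebesgue_tuple (n : nat) :
    {sigma_finite_measure set (n.-tuple mR) -> \bar R} :=
  match n with
  | 0 => [the {sigma_finite_measure set (0.-tuple mR) -> \bar R}
            of dirac [tuple] ]
  | n.+1 => [the {sigma_finite_measure set (n.+1.-tuple mR) -> \bar R}
            of lebesgue_cons (lebesgue_tuple n)]
  end.

End LebesgueMeasure.


Section Analysis.
Context (R : realType) (N : nat).
Local Notation U := 'rV[R]_N.

Definition row_of_tuple (t : N.-tuple (measurableTypeR R)) : U :=
  \row_i tnth t i.

Definition enorm (x : U) : R := Num.sqrt (\sum_i x 0 i ^+ 2).

Definition unit_ball_vol : R :=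
  fine (lebesgue_tuple N [set t | enorm (row_of_tuple t) < 1]).

Definition partial (i : 'I_N) (f : U -> R) : U -> R :=
  fun x => 'D_(delta_mx 0 i) (f : U -> R^o) x.

Definition partials (s : seq 'I_N) (f : U -> R) : U -> R := foldr partial f s.

(** Smooth: every iterated partial derivative is (Frechet) differentiable. *)
Definition smooth (f : U -> R) : Prop :=
  forall (s : seq 'I_N) (x : U), differentiable (partials s f : U -> R^o) x.

Definition test_function (f : U -> R) : Prop :=
  smooth f /\ compact (closure [set x | f x != 0]).

Context (L : falgType R).

(** Coordinates in some basis of L; the notions below do not depend on it. *)
Definition coordL (i : 'I_(\dim {:L})) (v : L) : R := coord (vbasis {:L}) i v.

Definition integralL (f : U -> L) : L :=
  \sum_i (\int[lebesgue_tuple N]_t coordL i (f (row_of_tuple t)))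
           *: (vbasis {:L})`_i.

Definition locally_integrableL (f : U -> L) : Prop :=
  forall K : set U, compact K -> forall i,
    (lebesgue_tuple N).-integrable (row_of_tuple @^-1` K)
      (fun t => (coordL i (f (row_of_tuple t)))%:E).

(** A family [w : {set 'I_N} -> V] stands for \sum_J w_J dx_J, where, for
    J = {j_1 < ... < j_k}, dx_J = dx_{j_1} /\ ... /\ dx_{j_k}.  The coefficients
    are L-valued functions for forms, L-valued distributions for currents.  A
    distribution is given by its values on real test functions, and is only ever
    evaluated on those. *)

Definition form := {set 'I_N} -> U -> L.
Definition distribution := (U -> R) -> L.
Definition current := {set 'I_N} -> distribution.

(** [wedge_dx i w] is dx_i /\ w: moving dx_i to its place in dx_J crosses the
    dx_j with j < i. *)
Definition wedge_dx (i : 'I_N) (w : {set 'I_N} -> L) (J : {set 'I_N}) : L :=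
  if i \in J then (-1) ^+ #|[set j in J | (j < i)%N]| *: w (J :\ i) else 0.

Definition dist_partial (i : 'I_N) (T : distribution) : distribution :=
  fun phi => - T (partial i phi).

Definition cr_op (c : L) (i j : 'I_N) (T : distribution) : distribution :=
  fun phi => dist_partial i T phi - c * dist_partial j T phi.

Definition current_of_form (w : form) : current :=
  fun J phi => integralL (fun x => phi x *: w J x).

Definition current_eq (S T : current) : Prop :=
  forall J phi, test_function phi -> S J phi = T J phi.

(** The current [0] = \delta_0 dx_1 /\ ... /\ dx_N. *)
Definition eval_origin : current :=
  fun J phi => if J == [set: 'I_N]%SET then (phi 0)%:A else 0.

End Analysis.

(** The coordinates y_i^j (i < n, j <= p) and theta_l^k (l < m, k < q), all
    indices starting from 0, are numbered from 0 in the order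
    y_0^0, ..., y_0^p, y_1^0, ..., theta_0^0, ..., theta_0^{q-1}, ...
    The dimension is written N = d+1; under d.+1 = n * p.+1 + m * q every index
    used below is in range, so that [inord] is the identity on it. *)

Section CauchyRiemann.
Context (R : realType) (L : falgType R) (n m p q r d : nat).
Context (e : p.+1.-tuple L) (s : nat -> nat) (a : q.-tuple L).
Local Notation N := d.+1.

Definition yidx (i j : nat) : nat := i * p.+1 + j.
Definition tidx (l k : nat) : nat := n * p.+1 + l * q + k.
Definition yco (i j : nat) : 'I_N := inord (yidx i j).
Definition tco (l k : nat) : 'I_N := inord (tidx l k).

Definition dbar (T : current N L) : current N L := fun J phi =>
  \sum_(i < n) \sum_(1 <= j < p.+1)
     wedge_dx (yco i j)
       (fun I => cr_op e`_j (yco i j) (yco i 0) (T I) phi) J +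
  \sum_(l < m) \sum_(k < r) \sum_((s k).+1 <= i < s k.+1)
     wedge_dx (tco l i)
       (fun I => cr_op a`_i (tco l i) (tco l (s k)) (T I) phi) J.

(** dx_1 /\ ... /\ dx_N with dx_i omitted *)
Definition dx_hat (i : 'I_N) : {set 'I_N} -> R :=
  fun J => (J == [set~ i]%SET)%:R.

Definition Omega : form N L := fun J x =>
  let y i j := x 0 (yco i j) in
  let theta l k := x 0 (tco l k) in
  let c := (N%:R * unit_ball_vol R N)^-1 in
  (c / enorm x ^+ N) *:
    (\sum_(i < n) \sum_(1 <= j < p.+1)
        ((-1) ^+ yidx i j * dx_hat (yco i j) J) *:
          (y i j *: e`_0 + y i 0 *: e`_j) +
     \sum_(l < m) \sum_(k < r) \sum_((s k).+1 <= i < s k.+1)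
        ((-1) ^+ tidx l i * dx_hat (tco l i) J) *:
          (theta l i *: e`_0 + theta l (s k) *: a`_i)).

(** The coefficients of [w] have to be locally integrable for [w] to be a
    current. *)
Definition fundamental_solution (w : form N L) : Prop :=
  (forall J, locally_integrableL (w J)) /\
  current_eq (dbar (current_of_form w)) (@eval_origin R N L).

End CauchyRiemann.

(* Main.v *)
Require Import Defs.
From mathcomp Require Import all_boot all_order all_algebra.
From mathcomp Require Import falgebra.
From mathcomp Require Import all_classical all_reals all_analysis.
From mathcomp Require Import measurable_realfun.
From mathcomp Require Import ring lra.

Set Implicit Arguments.
Unset Strict Implicit.
Unset Printing Implicit Defensive.

Import Order.TTheory GRing.Theory Num.Theory.
Import numFieldNormedType.Exports.

Local Open Scope classical_set_scope.
Local Open Scope ring_scope.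

(** Write N for the dimension and K(x) = c / |x|^N.  Call a coordinate al good
    when d'' has a term dx_al /\ (D_al - c_al D_be), where be is the first
    coordinate of the group of al (y_i^0, resp. theta_l^(s_k)) and c_al is e_j,
    resp. a_i.  The wedge with dx_al kills every summand of Omega except the one
    in which dx_al is omitted, and the two signs cancel, so that the coefficient
    of d''Omega is
      sum_(al good) (D_al - c_al D_be) (K (x_al + c_al x_be))
        = sum_(al good) (D_al (K x_al) - c_al^2 D_be (K x_be))
          + sum_(al good) c_al (D_al (K x_be) - D_be (K x_al)).
    The last sum is zero because the field x / |x|^N is curl free, also at the
    origin ([rotation_identity]).  In each group the squares of the
    coefficients, that of be being 1, add up to 0 by (A_0) or (A_1); so the
    terms in D_be (K x_be) of a group add up to a single D_be (K x_be), and what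
    remains is the divergence of K x over all coordinates, which is the Dirac
    mass at the origin ([euler_identity]).  Tested against f, these two facts
    say that the matrix of integrals of x_i D_j f / |x|^N is symmetric
    ([moment_sym]) and has trace - N Vol(B) f(0) ([moment_trace]).

    For the trace, scaling of Lebesgue measure and two
    applications of Tonelli give, for h nonnegative with h(0) = 0 ([polar]),
      int h(z) / |z|^N dz = N int_(|t| < 1) int_(r > 0) h(r t) / r dr dt.
    With h(z) the positive or negative part of sum_i z_i D_i f(z), the
    integrand h(r t) / r is that part of the derivative of r |-> f(r t), so
    that the difference of the two inner integrals is - f(0) whenever t != 0
    ([integral_ray]).  With h(z) = |z| on a ball, the same formula gives the
    local integrability of x_i / |x|^N ([radial_integrable]).

    For the symmetry, |x|^-N is replaced by the smooth (|x|^2 + e)^(-N/2), for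
    which the identity is the vanishing of the integral of a partial derivative
    ([integral_partial0], from translation invariance), and e tends to 0 by
    dominated convergence. *)

(** * Lebesgue measure on tuples under dilations and translations *)

Section LebesgueTuple.
Context {R : realType}.
Local Notation mR := (measurableTypeR R).
Local Notation lam := (@lebesgue_tuple R).

Section Affine1.
Context (b c : R).
Hypothesis c0 : 0 < c.
Let g (x : mR) : mR := b + c * x.

Let mg : measurable_fun setT g.
Proof. by apply: measurable_funD => //; exact: measurable_funM. Qed.

Let nu : {measure set mR -> \bar R} :=
  measure_function_pushforward__canonical__measure_function_Measure
    lebesgue_measure mg.

Let mu : {measure set mR -> \bar R} := mscale (NngNum (ltW c0)) nu.

(** Measures on the line are determined by their values on half-open intervals. *)
Let lebesgue_measure_affine (A : set mR) : measurable A ->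
  lebesgue_measure A = mu A.
Proof.
apply: lebesgue_measure_unique => // _ [[x y]] _ <-.
rewrite /mu /nu /mscale /= /pushforward.
have gE : g @^-1` [set` `]x, y]] = `](x - b) / c, (y - b) / c]%classic.
  by apply/seteqP; split => z /=;
    rewrite !in_itv /= /g ltr_pdivrMr// ler_pdivlMr//
    ltrBlDl lerBrDl (mulrC z).
rewrite [X in _ = (_ * lebesgue_measure X)%E]gE !lebesgue_measure_itv/= !lte_fin
  ltr_pM2r ?invr_gt0// ltrD2r.
case: ifPn => _; last by rewrite mule0.
by rewrite -!EFinD -EFinM; congr EFin; field; rewrite gt_eqF.
Qed.

Lemma ge0_integral_affine1 (f : mR -> \bar R) :
  measurable_fun setT f -> (forall x, 0 <= f x)%E ->
  (\int[lebesgue_measure]_x f x =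
   c%:E * \int[lebesgue_measure]_x f (b + c * x)%R)%E.
Proof.
move=> mf f0; transitivity (\int[mu]_x f x)%E.
  by apply: eq_measure_integral => A mA _; exact: lebesgue_measure_affine.
rewrite ge0_integral_mscale//; congr (_ * _)%E.
by rewrite ge0_integral_pushforward.
Qed.

End Affine1.

(** Tonelli for the recursive definition of the measure on tuples. *)
Lemma ge0_integral_tupleS n (f : n.+1.-tuple mR -> \bar R) :
  measurable_fun setT f -> (forall x, 0 <= f x)%E ->
  (\int[lam n.+1]_x f x =
   \int[lebesgue_measure]_x \int[lam n]_t f (tcons (x, t)))%E.
Proof.
move=> mf f0.
have mc := @measurable_tcons R n.
transitivity (\int[pushforward (lebesgue_measure \x lam n) (@tcons R n)]_x f
  x)%E.
  exact: eq_measure_integral.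
rewrite ge0_integral_pushforward// preimage_setT.
rewrite fubini_tonelli1//; last by move=> x; exact: f0.
exact: measurableT_comp.
Qed.

Definition affine n (v : n.-tuple mR) (c : R) (t : n.-tuple mR) : n.-tuple mR :=
  [tuple tnth v i + c * tnth t i | i < n].

Lemma measurable_affine n (v : n.-tuple mR) (c : R) :
  measurable_fun setT (affine v c).
Proof.
apply/measurable_fun_tnthP => i; rewrite /comp.
under eq_fun do rewrite tnth_mktuple.
apply: measurable_funD => //; apply: measurable_funM => //.
exact: measurable_tnth.
Qed.

Lemma affine_tcons n (v : n.+1.-tuple mR) c x (t : n.-tuple mR) :
  affine v c (tcons (x, t)) =
  tcons (thead v + c * x, affine [tuple of behead v] c t).
Proof.
apply: eq_from_tnth => i; rewrite tnth_mktuple /tcons /=.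
case: (unliftP ord0 i) => [j|] ->; last by rewrite !tnth0.
by rewrite !tnthS tnth_mktuple tnth_behead; congr (tnth v _ + _);
  apply: val_inj; rewrite /= inordK// ltnS.
Qed.

(** Induction on the dimension: each coordinate contributes one factor c. *)
Lemma ge0_integral_affine n (v : n.-tuple mR) (c : R) (f : n.-tuple mR ->
  \bar R) :
  0 < c -> measurable_fun setT f -> (forall x, 0 <= f x)%E ->
  (\int[lam n]_t f t = (c ^+ n)%:E * \int[lam n]_t f (affine v c t))%E.
Proof.
move=> c0; elim: n v f => [|n IH] v f mf f0.
  rewrite expr0 mul1e; apply: eq_integral => t _.
  by congr f; rewrite tuple0; apply/esym; rewrite tuple0.
rewrite ge0_integral_tupleS// (ge0_integral_tupleS (f := f \o affine v c));
  last 2 first.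
- by apply: measurableT_comp => //; exact: measurable_affine.
- by move=> x; exact: f0.
have mfc : measurable_fun setT (fun z : mR * n.-tuple mR => f (tcons z)).
  by apply: (measurableT_comp mf); exact: measurable_tcons.
have mfc1 (x : mR) : measurable_fun setT (fun t : n.-tuple mR => f (tcons (x,
  t))).
  exact: (measurableT_comp mfc (pair1_measurable x)).
pose F (x : mR) := (\int[lam n]_t f (tcons (x, t)))%E.
have mF : measurable_fun setT F.
  exact: (@measurable_fun_fubini_tonelli_F _ _ _ _ _ (lam n) (fun z => f (tcons
    z)) mfc (fun z => f0 _)).
have F0 x : (0 <= F x)%E by exact: integral_ge0.
rewrite -[LHS]/(\int[lebesgue_measure]_x F x)%E.
rewrite (ge0_integral_affine1 (thead v) c0 mF F0) exprS EFinM -muleA;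
  congr (_ * _)%E.
rewrite -ge0_integralZl//; last 3 first.
- apply: (@measurable_fun_fubini_tonelli_F _ _ _ _ _ (lam n) (fun z => f (affine
  v c (tcons z)))).
    apply: (measurableT_comp mf); apply: (measurableT_comp (measurable_affine v
      c)).
    exact: measurable_tcons.
  by move=> z; exact: f0.
- by move=> x _; apply: integral_ge0 => t _; exact: f0.
- by rewrite lee_fin exprn_ge0// ltW.
apply: eq_integral => x _; rewrite /F (IH [tuple of behead v])//.
by congr (_ * _)%E; apply: eq_integral => t _; rewrite /comp affine_tcons.
Qed.

Definition cube n (r : R) : set (n.-tuple mR) :=
  [set t | forall i, `|tnth t i| <= r].

Lemma measurable_cube n r : measurable (@cube n r).
Proof.
have -> : @cube n r = \bigcap_(i in [set: 'I_n]) ((@tnth _ mR ^~ i) @^-1` `[- r,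
  r]).
  apply/seteqP; split => t /= h i; first by move=> _;
    rewrite /= in_itv /= -ler_norml.
  by have := h i I; rewrite /= in_itv /= -ler_norml.
apply: fin_bigcap_measurable; first exact: finite_finset.
move=> i _; rewrite -[X in measurable X]setTI; apply: measurable_tnth => //.
Qed.

Lemma lebesgue_cube n r : 0 <= r -> lam n (cube r) = ((2 * r) ^+ n)%:E.
Proof.
move=> r0; elim: n => [|n IH].
  by rewrite /= diracE mem_set// => -[].
rewrite /= /lebesgue_cons /pushforward.
have -> : @tcons R n @^-1` cube r = `[- r, r] `*` cube r.
  apply/seteqP; split => -[x t] /=.
    move=> h; split => /=.
      by rewrite in_itv /= -ler_norml; have := h ord0; rewrite tnth0.
    by move=> i; have := h (lift ord0 i); rewrite tnthS.
  rewrite in_itv /= -ler_norml => -[xr h] i.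
  by case: (unliftP ord0 i) => [j|] ->; rewrite ?tnth0// tnthS.
rewrite product_measure1E//; last exact: measurable_cube.
rewrite exprS EFinM; congr (_ * _)%E; last exact: IH.
have rE : lebesgue_measure (`[- r, r]%classic : set mR) = (2 * r)%:E.
  rewrite lebesgue_measure_itv /= lte_fin.
  case: ltP => [_|h]; first by rewrite -EFinB opprK mulr_natl mulr2n.
  by congr EFin; lra.
exact: rE.
Qed.

End LebesgueTuple.

(** * Euclidean norm, measurability and volume on row vectors *)

Section Euclid.
Context {R : realType} {N : nat}.
Local Notation U := 'rV[R]_N.
Local Notation mR := (measurableTypeR R).
Implicit Types x : U.

Lemma enorm_ge0 x : 0 <= enorm x. Proof. exact: sqrtr_ge0. Qed.

Lemma sqr_enorm x : enorm x ^+ 2 = \sum_i x 0 i ^+ 2.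
Proof. by rewrite sqr_sqrtr// sumr_ge0// => i _; exact: sqr_ge0. Qed.

Lemma enorm_eq0 x : (enorm x == 0) = (x == 0).
Proof.
rewrite -sqrf_eq0 sqr_enorm psumr_eq0 => [|i _]; last exact: sqr_ge0.
apply/allP/eqP => [h|-> i _]; last by rewrite /= mxE expr0n eqxx.
apply/rowP => i; rewrite mxE; apply/eqP; rewrite -sqrf_eq0.
by apply: h; exact: mem_index_enum.
Qed.

Lemma enormZ (c : R) x : 0 <= c -> enorm (c *: x) = c * enorm x.
Proof.
move=> c0; have -> : c * enorm x =
  Num.sqrt (c ^+ 2) * enorm x by rewrite sqrtr_sqr ger0_norm.
rewrite /enorm -sqrtrM ?sqr_ge0//.
by congr Num.sqrt; rewrite mulr_sumr; apply: eq_bigr => i _; rewrite mxE exprMn.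
Qed.

Lemma coord_le_enorm x i : `|x 0 i| <= enorm x.
Proof.
rewrite -sqrtr_sqr; apply: ler_wsqrtr; rewrite (bigD1 i)//= lerDl.
by apply: sumr_ge0 => j _; exact: sqr_ge0.
Qed.

Lemma sqr_enorm_differentiable x :
  differentiable (fun x : U => \sum_i x 0 i ^+ 2 : R^o) x.
Proof.
have -> : (fun x : U => \sum_i x 0 i ^+ 2 : R^o) =
    \sum_(i < N) (fun x : U => x 0 i ^+ 2).
  by apply/funext => y; rewrite fct_sumE.
apply: differentiable_sum => i.
have -> : (fun x : U => x 0 i ^+ 2) = (fun x : U => x 0 i : R) ^+ 2 by [].
by apply: differentiableX; exact: differentiable_coord.
Qed.

Lemma enorm_continuous : continuous (@enorm R N).
Proof.
move=> x; apply: (@continuous_comp _ _ _ _ Num.sqrt);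
  last exact: sqrt_continuous.
exact/differentiable_continuous/sqr_enorm_differentiable.
Qed.

(** The sigma-algebra lives on tuples and the topology on row vectors;
    measurability of a function of a row vector is that of its composite with
    the identification of the two. *)
Definition row_measurable (f : U -> R) :=
  measurable_fun [set: N.-tuple mR] (f \o @row_of_tuple R N).

(** An open set is the union of the countably many boxes with rational center
    and radius 1/(k+1) that it contains. *)
Lemma measurable_open (A : set U) : open A ->
  measurable (@row_of_tuple R N @^-1` A).
Proof.
move=> oA.
pose box (u : 'rV[rat]_N * nat) : set (N.-tuple mR) :=
  [set t | forall i, `|ratr (u.1 0 i) - tnth t i| < u.2.+1%:R^-1].
have mbox u : measurable (box u).
  have -> : box u = \bigcap_(i in [set: 'I_N])
     ((@tnth _ mR ^~ i) @^-1` `](ratr (u.1 0 i) - u.2.+1%:R^-1),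
       (ratr (u.1 0 i) + u.2.+1%:R^-1)[).
    apply/seteqP; split => t /= h i; first by move=> _;
      rewrite /= in_itv /= -ltr_distl distrC.
    by have := h i I; rewrite /= in_itv /= -ltr_distl distrC.
  apply: (@fin_bigcap_measurable _ _ _ [set: 'I_N]) => [|i _];
    first exact: finite_finset.
  rewrite -[X in measurable X]setTI; apply: measurable_tnth => //.
pose F u := if asbool (box u `<=` @row_of_tuple R N @^-1` A) then box u else
  set0.
have -> : @row_of_tuple R N @^-1` A = \bigcup_u F u.
  apply/seteqP; split => t /=; last first.
    by move=> [u _]; rewrite /F; case: asboolP => // h /h.
  move=> At; move: oA; rewrite openE => /(_ _ At) /nbhs_ballP [r /= r0 rA].
  have [k kr] : exists k : nat, k.+1%:R^-1 < r / 2.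
    exists (Num.truncn (r / 2)^-1);
      rewrite -[X in _ < X]invrK ltf_pV2 ?posrE ?invr_gt0 ?divr_gt0//.
    exact: truncnS_gt.
  have k0 : 0 < k.+1%:R^-1 :> R by rewrite invr_gt0.
  have : forall i, exists q : rat, `|ratr q - tnth t i| < k.+1%:R^-1.
    move=> i; have /rat_in_itvoo[q] : tnth t i - k.+1%:R^-1 < tnth t i +
      k.+1%:R^-1.
      by rewrite ltrD2l; apply: (@lt_trans _ _ 0) => //; rewrite oppr_lt0.
    by rewrite in_itv /= -ltr_distl => ?; exists q.
  move=> /choice[q qt].
  exists (\row_i q i, k) => //; rewrite /F; case: asboolP => [_|[]];
    first by move=> i; rewrite /= mxE.
  (* t and u are both within 1/(k+1) < r/2 of the rational point q. *)
  move=> u /= uq; apply: rA; split => // i j; rewrite !mxE /ball /=.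
  rewrite (le_lt_trans (ler_distD (ratr (q j)) _ _))// -(divfK (x := 2) _ r)//.
  rewrite mulr_natr mulr2n ltrD// ?(lt_trans _ kr)//; first by rewrite distrC.
  by have := uq j; rewrite mxE.
apply: countable_bigcupT_measurable => // u.
by rewrite /F; case: asboolP.
Qed.

End Euclid.

Section RowLebesgue.
Context {R : realType} {N : nat}.
Local Notation U := 'rV[R]_N.
Local Notation mR := (measurableTypeR R).
Local Notation rt := (@row_of_tuple R N).
Local Notation lam := (@lebesgue_tuple R N).

Lemma continuous_row_measurable (f : U -> R) : continuous f -> row_measurable f.
Proof.
move=> cf; apply: (measurability _ (RGenOInfty.measurableE R)) => //.
move=> /= _ [_ [x ->] <-]; rewrite setTI comp_preimage.
apply: measurable_open; apply: open_comp => [y _|]; first exact: cf.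
exact: interval_open.
Qed.

Lemma row_measurable_enorm : row_measurable (@enorm R N).
Proof. by apply: continuous_row_measurable; exact: enorm_continuous. Qed.

Lemma row_measurable_affine (f : U -> R) (v : U) (c : R) :
  row_measurable f -> row_measurable (fun x => f (v + c *: x)).
Proof.
move=> mf; pose w := [tuple v 0 i | i < N] : N.-tuple mR.
rewrite /row_measurable (_ : _ \o rt = (f \o rt) \o affine w c).
  exact: (measurableT_comp mf (measurable_affine w c)).
apply/funext => t /=; congr f; apply/rowP => i.
by rewrite !mxE /w !tnth_mktuple.
Qed.

Lemma row_measurable_dilation (f : U -> R) : row_measurable f ->
  measurable_fun [set: N.-tuple mR * mR] (fun z => f (z.2 *: rt z.1)).
Proof.
move=> mf.
pose g (z : N.-tuple mR * mR) : N.-tuple mR := [tuple z.2 * tnth z.1 i | i < N].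
rewrite (_ : (fun z => _) = (f \o rt) \o g); last first.
  by apply/funext => z /=; congr f; apply/rowP => i; rewrite !mxE !tnth_mktuple.
apply: (measurableT_comp mf); apply/measurable_fun_tnthP => i; rewrite /comp.
under eq_fun do rewrite tnth_mktuple.
apply: measurable_funM => //.
by apply: (measurableT_comp (measurable_tnth i)).
Qed.

Lemma ge0_integral_row_affine (f : U -> R) (v : U) (c : R) : 0 < c ->
  row_measurable f -> (forall x, 0 <= f x) ->
  (\int[lam]_t (f (rt t))%:E =
   (c ^+ N)%:E * \int[lam]_t (f (v + c *: rt t))%:E)%E.
Proof.
move=> c0 mf f0; pose w := [tuple v 0 i | i < N] : N.-tuple mR.
rewrite (@ge0_integral_affine R N w c (EFin \o (f \o rt))) //.
- congr (_ * _)%E; apply: eq_integral => t _ /=; congr (f _)%:E;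
  apply/rowP => i.
  by rewrite !mxE /w !tnth_mktuple.
- exact/measurable_EFinP.
- by move=> x; rewrite lee_fin; exact: f0.
Qed.

Lemma measurable_row_ball (r : R) : measurable [set t | enorm (rt t) < r].
Proof.
rewrite -[X in measurable X]setTI.
apply: (measurable_fun_ltr row_measurable_enorm (measurable_cst r) measurableT)
  => //.
Qed.

Lemma row_ball_sub_cube r : [set t | enorm (rt t) < r] `<=` cube r.
Proof.
move=> t /= tr i; apply: ltW; apply: le_lt_trans tr.
by have := coord_le_enorm (rt t) i; rewrite mxE.
Qed.

Lemma lebesgue_row_ball_lty (r : R) : (lam [set t | (enorm (rt t) < r)%R] <
  +oo)%E.
Proof.
apply: (@le_lt_trans _ _ (lam (cube `|r|)));
  last by rewrite lebesgue_cube// ltry.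
apply: le_measure; rewrite ?inE//;
  [exact: measurable_row_ball|exact: measurable_cube|].
move=> t tr; apply: row_ball_sub_cube => /=; apply: lt_le_trans tr _.
exact: ler_norm.
Qed.

(** The volume of the unit ball is defined with [fine], which would send an
    infinite measure to 0. *)
Lemma lebesgue_unit_ball :
  (lam [set t | (enorm (rt t) < 1)%R] = (unit_ball_vol R N)%:E)%E.
Proof. by rewrite fineK// ge0_fin_numE// lebesgue_row_ball_lty. Qed.

(** The ball contains the cube of half-width r = 1/(N+1), since N r^2 < 1. *)
Lemma unit_ball_vol_gt0 : 0 < unit_ball_vol R N.
Proof.
rewrite -lte_fin -lebesgue_unit_ball.
pose r : R := N.+1%:R^-1; have r0 : 0 < r by rewrite invr_gt0.
apply: (@lt_le_trans _ _ (lam (cube r))).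
  by rewrite lebesgue_cube ?ltW// lte_fin exprn_gt0// mulr_gt0.
apply: le_measure; rewrite ?inE//;
  [exact: measurable_cube|exact: measurable_row_ball|].
move=> t tr /=; rewrite -(@ltr_pXn2r _ 2)// ?nnegrE ?enorm_ge0// sqr_enorm
  expr1n.
apply: (@le_lt_trans _ _ (\sum_(i < N) r ^+ 2)).
  apply: ler_sum => i _; rewrite -real_normK ?num_real// mxE.
  by rewrite ler_pXn2r ?nnegrE// ltW.
rewrite sumr_const card_ord -mulr_natl.
have Nr : N%:R * r < 1 by rewrite ltr_pdivrMr// mul1r ltr_nat.
have r1 : r <= 1 by rewrite invf_le1// ler1n.
by rewrite expr2 mulrA (le_lt_trans _ Nr)// ler_piMr// mulr_ge0// ltW.
Qed.

End RowLebesgue.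

(** The origin is a cube of width 0, hence null in positive dimension. *)
Lemma origin_cube {R : realType} {N : nat} :
  [set t | @row_of_tuple R N t = 0] = cube 0.
Proof.
apply/seteqP; split => t /=.
  by move=> /rowP t0 i; have := t0 i; rewrite !mxE => ->; rewrite normr0.
by move=> t0; apply/rowP => i; rewrite !mxE; apply/eqP; rewrite -normr_le0;
  exact: t0.
Qed.

Lemma lebesgue_origin {R : realType} {d : nat} :
  @lebesgue_tuple R d.+1 [set t | @row_of_tuple R d.+1 t = 0] = 0%E.
Proof. by rewrite origin_cube lebesgue_cube// mulr0 expr0n. Qed.

(** * Integration along rays *)

Section Polar.
Context {R : realType} {d : nat}.
Local Notation N := d.+1.
Local Notation U := 'rV[R]_N.
Local Notation mR := (measurableTypeR R).
Local Notation rt := (@row_of_tuple R N).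
Local Notation lam := (@lebesgue_tuple R N).
Local Notation leb := (@lebesgue_measure R).

(** On nonnegative reals the inverse is the power -1, and both are 0 at 0. *)
Lemma measurable_invr_ge0 d0 (T : measurableType d0) (f : T -> R) :
  (forall x, 0 <= f x) -> measurable_fun [set: T] f ->
  measurable_fun [set: T] (fun x => (f x)^-1).
Proof.
move=> f0 mf; rewrite (_ : (fun x => _) = (@powR R ^~ (-1)) \o f).
  by apply: measurableT_comp => //; exact: measurable_powR.
by apply/funext => x /=; rewrite powR_inv1.
Qed.

Lemma integral_tail (a : R) : 0 < a ->
  (\int[leb]_(x in `[a, +oo[) ((x ^+ d.+2)^-1)%:E = ((N%:R * a ^+ N)^-1)%:E)%E.
Proof.
move=> a0.
pose F (x : R) : R := - N%:R^-1 * (x ^+ N)^-1.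
have dF (x : R) : 0 < x -> is_derive x (1 : R) F ((x ^+ d.+2)^-1).
  move=> x0.
  have x1 : x != 0 by rewrite gt_eqF.
  have xN : (x ^+ N) != 0 by rewrite expf_neq0.
  have -> : (x ^+ d.+2)^-1 = - N%:R^-1 *: (- (x ^+ N) ^- 2 *: ((N%:R * x ^+ d)
    *: 1)).
    rewrite /GRing.scale /= mulr1 !exprS expr0; field.
    by rewrite x1 expf_neq0//= -natr1 natr1 pnatr_eq0.
  have dN := @is_deriveX R R id N x 1 1 (@is_derive_id _ _ _ _).
  have dN' : is_derive x 1 (fun x : R => x ^+ N) ((N%:R * x ^+ d) *: 1).
    by rewrite (_ : (fun x : R => x ^+ N) = id ^+ N)//; apply/funext => y;
      rewrite exprfctE.
  have := @is_deriveV R (fun x : R => x ^+ N) x _ 1 xN dN'.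
  exact: is_deriveZ.
have Fa : {for a, continuous F}.
  apply: differentiable_continuous; apply/derivable1_diffP.
  by have [] := dF a a0.
rewrite (@ge0_continuous_FTC2y R (fun x => (x ^+ d.+2)^-1) F a 0).
- by rewrite sub0e -EFinN /F mulNr opprK invfM.
- by move=> x ax; rewrite invr_ge0 exprn_ge0// (le_trans (ltW a0)).
- apply: continuous_in_subspaceT => x; rewrite inE /= in_itv /= andbT => ax.
  apply: cvgV; first by rewrite expf_neq0// gt_eqF// (lt_le_trans a0).
  exact: exprn_continuous.
- apply/cvgr0Pnorm_lt => eps eps0; near=> x.
  have x1 : 1 <= x by near: x; apply: nbhs_pinfty_ge; exact: num_real.
  have x0 : 0 < x by exact: lt_le_trans x1.
  rewrite /F mulNr normrN ger0_norm ?mulr_ge0 ?invr_ge0 ?exprn_ge0 1?ltW//.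
  apply: (@le_lt_trans _ _ x^-1).
    rewrite -invfM lef_pV2 ?posrE ?mulr_gt0 ?exprn_gt0//.
    apply: (le_trans (ler_eXnr (ltn0Sn d) x1)).
    by apply: ler_peMl; [rewrite exprn_ge0// ltW|rewrite ler1n].
  rewrite -(invrK eps) ltf_pV2 ?posrE ?invr_gt0//.
  by near: x; apply: nbhs_pinfty_gt; exact: num_real.
- by move=> x ax; have [] := dF x (lt_trans a0 ax).
- exact: cvg_at_right_filter.
- move=> x; rewrite in_itv /= andbT => ax; rewrite derive1E.
  by have [_ ->] := dF x (lt_trans a0 ax).
Unshelve. all: by end_near. Qed.

Lemma integral_tail_indic (a : R) : 0 < a ->
  (\int[leb]_x (if (a < x)%R then (x ^+ d.+2)^-1 else 0)%:E =
   ((N%:R * a ^+ N)^-1)%:E)%E.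
Proof.
move=> a0; rewrite -integral_tail// -integral_itv_obnd_cbnd; last first.
  apply/measurable_EFinP; apply: open_continuous_measurable_fun => // x.
  rewrite inE /= in_itv /= andbT => ax.
  apply: cvgV; first by rewrite expf_neq0// gt_eqF// (lt_trans a0).
  exact: exprn_continuous.
rewrite [RHS]integral_mkcond; apply: eq_integral => x _; rewrite patchE.
by rewrite mem_setE in_itv /= andbT; case: ifP.
Qed.

(** The half-line through each point of the unit ball carries the measure dr/r,
    which is invariant under dilations; no Jacobian appears until Tonelli is
    applied. *)
Definition polar_integrand (h : U -> R) (z : N.-tuple mR * mR) : R :=
  if (enorm (rt z.1) < 1) && (0 < z.2) then h (z.2 *: rt z.1) / z.2 else 0.

Lemma measurable_enorm_fst :
  measurable_fun [set: N.-tuple mR * mR] (fun z => enorm (rt z.1)).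
Proof.
by apply: (measurableT_comp row_measurable_enorm); exact: measurable_fst.
Qed.

Lemma measurable_polar_integrand (h : U -> R) : row_measurable h ->
  measurable_fun setT (polar_integrand h).
Proof.
move=> mh; rewrite (_ : polar_integrand h =
  fun z => if (enorm (rt z.1) < 1) && (0 < z.2)
     then h (z.2 *: rt z.1) / `|z.2| else 0); last first.
  by apply/funext => z; rewrite /polar_integrand;
    case: ifPn => // /andP[_ /gtr0_norm ->].
have me := measurable_enorm_fst.
apply: measurable_fun_ifT => //.
  by apply: measurable_and; apply: measurable_fun_ltr.
apply: measurable_funM; first exact: row_measurable_dilation.
by apply: measurable_invr_ge0 => //; apply: measurableT_comp.
Qed.

Lemma measurable_polar_integrand2 (h : U -> R) t : row_measurable h ->
  measurable_fun setT (fun r => (polar_integrand h (t, r))%:E).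
Proof.
move=> mh; apply/measurable_EFinP.
exact: (measurable_fun_pair2 t (measurable_polar_integrand mh)).
Qed.

Lemma polar_integrand_ge0 (h : U -> R) z : (forall x, 0 <= h x) ->
  0 <= polar_integrand h z.
Proof.
move=> h0; rewrite /polar_integrand; case: ifPn => // /andP[_ /ltW z0].
by rewrite divr_ge0.
Qed.

Lemma measurable_radial_integral (h : U -> R) : row_measurable h ->
  (forall x, 0 <= h x) ->
  measurable_fun setT (fun t => \int[leb]_r (polar_integrand h (t, r))%:E)%E.
Proof.
move=> mh h0.
apply: (@measurable_fun_fubini_tonelli_F _ _ _ _ _ leb (EFin \o polar_integrand
  h)).
  by apply/measurable_EFinP; exact: measurable_polar_integrand.
by move=> z; rewrite lee_fin; exact: polar_integrand_ge0.
Qed.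

(** For fixed r, the dilation z = r t turns the integral over the unit ball
    into r^-N times the integral of h over the ball of radius r.  Exchanging the
    integrals again leaves h(z) times the integral of r^-(N+1) over r > |z|,
    which is 1 / (N |z|^N).  At z = 0 this last integral diverges, hence the
    hypothesis h 0 = 0. *)
Lemma polar (h : U -> R) : row_measurable h -> (forall x,
  0 <= h x) -> h 0 = 0 ->
  (\int[lam]_t (h (rt t) / enorm (rt t) ^+ N)%:E =
   N%:R%:E * \int[lam]_t \int[leb]_r (polar_integrand h (t, r))%:E)%E.
Proof.
move=> mh h0 h00; have me := measurable_enorm_fst.
have mh1 : measurable_fun [set: N.-tuple mR * mR] (fun z => h (rt z.1)).
  by apply: (measurableT_comp mh); exact: measurable_fst.
pose F := polar_integrand h.
(* The absolute value, harmless where r > |z|, makes the inverse measurable. *)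
pose G (z : N.-tuple mR * mR) : R :=
  if (enorm (rt z.1) < z.2) then h (rt z.1) / `|z.2| ^+ d.+2 else 0.
have mF : measurable_fun setT F by exact: measurable_polar_integrand.
have F0 z : 0 <= F z by exact: polar_integrand_ge0.
have mG : measurable_fun setT G.
  apply: measurable_fun_ifT => //; first exact: measurable_fun_ltr.
  apply: measurable_funM => //; apply: measurable_invr_ge0.
    by move=> x; rewrite exprn_ge0.
  by apply: measurable_funX; apply: measurableT_comp.
have G0 z : 0 <= G z.
  by rewrite /G; case: ifPn => // _; rewrite divr_ge0// exprn_ge0.
rewrite (fubini_tonelli (EFin \o F)); last 2 first.
- exact/measurable_EFinP.
- by move=> z; rewrite lee_fin; exact: F0.
transitivity (N%:R%:E * \int[leb]_r \int[lam]_t (G (t, r))%:E)%E; last first.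
  congr (_ * _)%E; apply: eq_integral => r _ /=.
  have [r0|r0] := leP r 0.
    rewrite integral0_eq => [|t _]; last first.
      by rewrite /G /= ltNge (le_trans r0)// enorm_ge0.
    by rewrite integral0_eq// => t _;
      rewrite /F /polar_integrand /= (ltNge 0) r0 andbF.
  pose g x := if enorm x < r then h x / r ^+ d.+2 else 0.
  have mg : row_measurable g.
    apply: measurable_fun_ifT => //.
      by apply: measurable_fun_ltr => //; exact: row_measurable_enorm.
    exact: measurable_funM.
  have g0 x : 0 <= g x.
    by rewrite /g; case: ifPn => // _; rewrite divr_ge0// exprn_ge0// ltW.
  transitivity (\int[lam]_t (g (rt t))%:E)%E.
    by apply: eq_integral => t _; rewrite /G /g /= gtr0_norm.
  rewrite (ge0_integral_row_affine 0 r0 mg g0) -ge0_integralZl//; last 3 first.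
  - by apply/measurable_EFinP; exact: row_measurable_affine.
  - by move=> t _; rewrite lee_fin.
  - by rewrite lee_fin exprn_ge0// ltW.
  apply: eq_integral => t _; rewrite -EFinM; congr EFin.
  rewrite /g /F /polar_integrand /= add0r r0 andbT enormZ ?ltW// gtr_pMr//.
  case: ifPn => _; last by rewrite mulr0.
  rewrite mulrCA; congr (_ * _); rewrite [r ^+ d.+2]exprS invfM mulrCA mulfV
    ?mulr1//.
  by rewrite expf_neq0// gt_eqF.
rewrite -(fubini_tonelli (EFin \o G)); last 2 first.
- exact/measurable_EFinP.
- by move=> z; rewrite lee_fin; exact: G0.
rewrite -ge0_integralZl//; last 2 first.
- apply: (@measurable_fun_fubini_tonelli_F _ _ _ _ _ leb (EFin \o G)).
    exact/measurable_EFinP.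
  by move=> z; rewrite lee_fin; exact: G0.
- by move=> t _; apply: integral_ge0 => r _; rewrite lee_fin; exact: G0.
apply: eq_integral => t _ /=.
have [x0|x0] := eqVneq (rt t) 0.
  rewrite integral0_eq ?x0 ?h00 ?mul0r ?mule0// => r _.
  by rewrite /G /= x0 h00 mul0r; case: ifP.
have e0 : 0 < enorm (rt t) by rewrite lt_neqAle enorm_ge0 eq_sym enorm_eq0 x0.
transitivity (N%:R%:E * \int[leb]_r ((h (rt t))%:E *
   (if (enorm (rt t) < r)%R then (r ^+ d.+2)^-1 else 0)%:E))%E.
  rewrite ge0_integralZl//; last 3 first.
  - apply/measurable_EFinP.
    rewrite (_ : (fun x => _) = fun x : mR => if enorm (rt t) < x then (`|x| ^+
      d.+2)^-1 else 0).
      apply: measurable_fun_ifT => //; first exact: measurable_fun_ltr.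
      apply: measurable_invr_ge0; first by move=> x; rewrite exprn_ge0.
      by apply: measurable_funX.
    by apply/funext => x; case: ifPn => // ex;
      rewrite gtr0_norm// (lt_trans e0).
  - move=> x _; case: ifPn => // ex; rewrite lee_fin invr_ge0 exprn_ge0//.
    by rewrite ltW// (lt_trans e0).
  - by rewrite lee_fin.
  rewrite integral_tail_indic// -!EFinM; congr EFin.
  by rewrite invfM mulrCA; congr (_ * _);
    rewrite mulrA mulfV ?mul1r// pnatr_eq0.
congr (_ * _)%E; apply: eq_integral => r _; rewrite -EFinM; congr EFin.
rewrite /G /=; case: ifPn => [er|]; last by rewrite mulr0.
by rewrite gtr0_norm// (lt_trans e0).
Qed.

End Polar.

(** * Local integrability of x / |x|^N *)

Section Integrability.
Context {R : realType} {d : nat}.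
Local Notation N := d.+1.
Local Notation U := 'rV[R]_N.
Local Notation mR := (measurableTypeR R).
Local Notation rt := (@row_of_tuple R N).
Local Notation lam := (@lebesgue_tuple R N).
Local Notation leb := (@lebesgue_measure R).

Lemma row_measurable_kernel (f : U -> R) : row_measurable f ->
  row_measurable (fun x => f x / enorm x ^+ N).
Proof.
move=> mf; apply: measurable_funM => //.
apply: (measurable_invr_ge0 (f := fun t => enorm (rt t) ^+ N)).
  by move=> x; rewrite exprn_ge0// enorm_ge0.
by apply: measurable_funX; exact: row_measurable_enorm.
Qed.

Lemma row_measurable_cutoff (M : R) (f : U -> R) : row_measurable f ->
  row_measurable (fun x => if enorm x <= M then f x else 0).
Proof.
move=> mf; apply: measurable_fun_ifT => //.
by apply: measurable_fun_ler => //; exact: row_measurable_enorm.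
Qed.

(** By [polar] the integral is N times that over the unit ball of
    |t| times the length of the interval of r such that r |t| <= M; this
    product is at most M. *)
Lemma radial_integrable (M : R) : 0 < M ->
  lam.-integrable setT
    (fun t => ((if enorm (rt t) <= M then enorm (rt t) else 0) / enorm (rt t) ^+
      N)%:E).
Proof.
move=> M0; pose h (x : U) := if enorm x <= M then enorm x else 0.
have mh : row_measurable h.
  by apply: row_measurable_cutoff; exact: row_measurable_enorm.
have h0 x : 0 <= h x by rewrite /h; case: ifP => // _; exact: enorm_ge0.
have h00 : h 0 = 0.
  by rewrite /h; have /eqP -> : enorm (0 : U) == 0;
    [rewrite enorm_eq0|rewrite ltW].
have hE0 x : 0 <= h x / enorm x ^+ N by rewrite divr_ge0// exprn_ge0//
  enorm_ge0.
apply/integrableP; split.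
  by apply/measurable_EFinP; exact: (row_measurable_kernel mh).
under eq_integral => t _.
  rewrite gee0_abs ?lee_fin; last exact: hE0.
  over.
rewrite (polar mh h0 h00) lte_mul_pinfty ?lee_fin//.
apply: (@le_lt_trans _ _ (\int[lam]_t (if enorm (rt t) < 1 then M else
  0)%:E)%E).
  apply: ge0_le_integral => //.
  - by move=> t _; apply: integral_ge0 => r _;
    rewrite lee_fin polar_integrand_ge0.
  - exact: measurable_radial_integral.
  - apply/measurable_EFinP; apply: measurable_fun_ifT => //.
    by apply: measurable_fun_ltr => //; exact: row_measurable_enorm.
  move=> t _; case: ifPn => /= t1; last first.
    by rewrite integral0_eq// => r _; rewrite /polar_integrand /= (negbTE t1).
  have [x0|x0] := eqVneq (rt t) 0.
    rewrite integral0_eq ?lee_fin 1?ltW// => r _.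
    by rewrite /polar_integrand /= x0 scaler0 h00 mul0r; case: ifP.
  have e0 : 0 < enorm (rt t) by rewrite lt_neqAle enorm_ge0 eq_sym enorm_eq0 x0.
  apply: (@le_trans _ _ (\int[leb]_r ((enorm (rt t))%:E * (\1_(`]0,
    (M / enorm (rt t))] : set R) r)%:E))%E); last first.
    rewrite ge0_integralZl//; last 2 first.
    - exact/measurable_EFinP/measurable_indic.
    - by rewrite lee_fin ltW.
    have lE : leb (`]0, (M / enorm (rt t))]%classic : set mR) =
      (M / enorm (rt t))%:E.
      by rewrite lebesgue_measure_itv /= lte_fin divr_gt0// sube0.
    by rewrite integral_indic// setIT [X in (_ * X)%E]lE -EFinM mulrC divfK
      ?gt_eqF.
  apply: ge0_le_integral => //.
  - by move=> r _; rewrite lee_fin polar_integrand_ge0.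
  - exact: measurable_polar_integrand2.
  - by apply/measurable_EFinP; apply: measurable_funM => //;
    exact: measurable_indic.
  move=> r _; rewrite -EFinM lee_fin /polar_integrand /= t1 /=;
    case: ifPn => r0; last by rewrite mulr_ge0// ltW.
  rewrite /h (enormZ _ (ltW r0)); case: ifPn => rM;
    last by rewrite mul0r mulr_ge0// ltW.
  have rin : (`]0, (M / enorm (rt t))]%classic : set R) r.
    by rewrite /= in_itv /= r0 ler_pdivlMr.
  by rewrite indicE (mem_set rin) mulr1 mulrAC mulfV ?mul1r// gt_eqF.
rewrite [X in (X < _)%E](_ : _ =
  \int[lam]_(t in [set t | (enorm (rt t) < 1)%R]) (cst M%:E t))%E.
  by rewrite integral_cst ?lte_mul_pinfty ?lee_fin 1?ltW
    ?lebesgue_row_ball_lty//; exact: measurable_row_ball.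
rewrite [RHS]integral_mkcond; apply: eq_integral => t _; rewrite patchE.
by case: ifPn => t1; [rewrite mem_set|rewrite memNset//; exact/negP].
Qed.

(** Used with f linear or with f a coordinate times a derivative of a test
    function: f is bounded near the origin by a multiple of |x|, which saves one
    degree over the critical |x|^-N. *)
Lemma kernel_integrable (M C : R) (f : U -> R) : 0 < M -> row_measurable f ->
  (forall x, `|f x| <= C * enorm x) -> (forall x, M < enorm x -> f x = 0) ->
  lam.-integrable setT (fun t => (f (rt t) / enorm (rt t) ^+ N)%:E).
Proof.
move=> M0 mf fC fM.
apply: (le_integrable _ _ _ (integrableZl _ `|C| (radial_integrable M0))) => //.
  by apply/measurable_EFinP; exact: row_measurable_kernel.
move=> t _; rewrite -EFinM !abse_EFin lee_fin mulrA !normrM.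
rewrite ler_wpM2r ?normr_ge0// normr_id; case: ifPn => tM.
  by rewrite (ger0_norm (enorm_ge0 _)) (le_trans (fC _))// ler_wpM2r
    ?enorm_ge0// ler_norm.
by rewrite fM ?ltNge// normr0 mulr0.
Qed.

End Integrability.

(** * Continuously differentiable functions with compact support *)

Lemma continuous_sum {R : realType} (T : topologicalType) n (g : 'I_n ->
  T -> R) :
  (forall i, continuous (g i)) -> continuous (fun x => \sum_i g i x).
Proof.
elim: n g => [|n IH] g cg x.
  rewrite (_ : (fun x => _) = cst 0); first exact: cvg_cst.
  by apply/funext => y; rewrite big_ord0.
rewrite (_ : (fun x => _) = fun x => g ord0 x + \sum_i g (lift ord0 i) x).
  by apply: cvgD; [exact: cg|apply: (IH (fun i => g (lift ord0 i)))].
by apply/funext => y; rewrite big_ord_recl.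
Qed.

Section C1.
Context {R : realType} {N : nat}.
Local Notation U := 'rV[R]_N.

(** The compact set S is a parameter so that products with a function of class
    C^1 keep the same one. *)
Definition C1c (S : set U) (f : U -> R) : Prop :=
  [/\ compact S, forall x, differentiable (f : U -> R^o) x,
      forall i, continuous (partial i f) & forall x, ~ S x -> f x = 0].

(** The complement of S is open, so f vanishes near x. *)
Lemma C1c_partial0 S f x i : C1c S f -> ~ S x -> partial i f x = 0.
Proof.
move=> [cS _ _ f0] Sx; rewrite /partial.
have : \near x, (f : U -> R^o) x = cst 0 x.
  have : open (~` S) by apply: closed_openC; exact: compact_closed.
  rewrite openE => /(_ x Sx); apply: filterS => y Sy; exact: f0.
by move=> /(near_eq_derive (delta_mx 0 i)) ->; rewrite derive_cst.
Qed.

Lemma C1c_bounded S f : C1c S f ->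
  exists2 M : R, 0 < M & forall x, S x -> enorm x < M.
Proof.
move=> [cS _ _ _].
have /compact_bounded [M [_ MS]] : compact (@enorm R N @` S).
  by apply: continuous_compact => //;
    exact/continuous_subspaceT/enorm_continuous.
exists (`|M| + 2); first by rewrite ltr_pwDr.
move=> x Sx; apply: (@le_lt_trans _ _ (`|M| + 1)); last by rewrite ltrD2l ltr1n.
rewrite -(ger0_norm (enorm_ge0 x)); apply: MS; last by exists x.
by rewrite (le_lt_trans (ler_norm M))// ltrDl.
Qed.

Lemma continuous_support_bounded S (g : U -> R) : compact S -> continuous g ->
  (forall x, ~ S x -> g x = 0) -> exists2 C : R, 0 <= C & forall x, `|g x| <= C.
Proof.
move=> cS cg g0.
have /compact_bounded [M [_ MS]] : compact (g @` S).
  by apply: continuous_compact => //; exact/continuous_subspaceT.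
exists (`|M| + 1) => // x; have [Sx|Sx] := pselect (S x);
  last by rewrite g0// normr0.
apply: MS; last by exists x.
by rewrite (le_lt_trans (ler_norm M))// ltrDl.
Qed.

(** The derivative of f in the direction of the position vector. *)
Definition euler_field (f : U -> R) (x : U) : R := \sum_i x 0 i * partial i f x.

Lemma derive_line (f : U -> R) (x v : U) : differentiable (f : U -> R^o) x ->
  'D_v (f : U -> R^o) x = \sum_i v 0 i * partial i f x.
Proof.
move=> df; rewrite deriveE// {1}(row_sum_delta v) linear_sum.
by apply: eq_bigr => i _; rewrite linearZ /partial deriveE.
Qed.

Lemma is_derive_line (f : U -> R) (x v : U) (r : R) :
  (forall x, differentiable (f : U -> R^o) x) ->
  is_derive r 1 (fun r : R => f (r *: v + x) : R^o) ('D_v (f : U ->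
    R^o) (r *: v + x)).
Proof.
move=> df.
have dx : differentiable (fun r : R => r *: v + x) r by exact: ex_diff.
have dc : differentiable (fun r : R => f (r *: v + x) : R^o) r.
  exact: (differentiable_comp dx (df _)).
apply: DeriveDef; first exact: diff_derivable.
rewrite deriveE// (diff_comp dx (df _)) /= diff_val deriveE//.
by congr ('d _ _ _); transitivity (1 *: v + 0) => //; rewrite scale1r addr0.
Qed.

Lemma is_derive_ray (f : U -> R) (x : U) (r : R) :
  (forall x, differentiable (f : U -> R^o) x) ->
  is_derive r 1 (fun r : R => f (r *: x) : R^o)
    (\sum_i x 0 i * partial i f (r *: x)).
Proof.
move=> df; rewrite -derive_line//.
have := @is_derive_line f 0 x r df; rewrite addr0.
by under eq_fun do rewrite addr0.
Qed.

End C1.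

(** * The radial identity: div (x / |x|^N) is a multiple of the Dirac mass *)

Section Euler.
Context {R : realType} {d : nat}.
Local Notation N := d.+1.
Local Notation U := 'rV[R]_N.
Local Notation mR := (measurableTypeR R).
Local Notation rt := (@row_of_tuple R N).
Local Notation lam := (@lebesgue_tuple R N).
Local Notation leb := (@lebesgue_measure R).
Variables (S : set U) (f : U -> R).
Hypothesis C1f : C1c S f.

Let df x : differentiable (f : U -> R^o) x. Proof. by case: C1f. Qed.

Let cf i : continuous (partial i f). Proof. by case: C1f. Qed.

Lemma euler_field_continuous : continuous (euler_field f).
Proof.
apply: (@continuous_sum R U N (fun i y => y 0 i * partial i f y)) => i x.
by apply: (@continuousM R U (fun y : U => y 0 i) (partial i f));
  [exact: coord_continuous|exact: cf].
Qed.

Lemma euler_field_out x : ~ S x -> euler_field f x = 0.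
Proof.
by move=> Sx; apply: big1 => i _; rewrite (C1c_partial0 i C1f Sx) mulr0.
Qed.

Lemma euler_field_le : exists C, forall x, `|euler_field f x| <= C * enorm x.
Proof.
have /choice[C fC] i : exists C, forall x, `|partial i f x| <= C.
  suff [C _ fC] : exists2 C, 0 <= C & forall x,
    `|partial i f x| <= C by exists C.
  apply: (@continuous_support_bounded R N S) => //; first by case: C1f.
  by move=> x; exact: C1c_partial0.
exists (\sum_i C i) => x; rewrite mulr_suml (le_trans (ler_norm_sum _ _ _))//.
by apply: ler_sum => i _; rewrite normrM mulrC ler_pM// coord_le_enorm.
Qed.

(** Along the ray the integrand is the derivative of r |-> f(r t), and f(r t) = 0
    for large r, so the fundamental theorem of calculus gives 0 - f(0). *)
Lemma integral_ray t : rt t != 0 -> enorm (rt t) < 1 ->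
  (\int[leb]_r (polar_integrand (euler_field f) (t, r))%:E = (- f 0)%:E)%E.
Proof.
move=> x0 x1; set x := rt t in x0 x1 *.
have e0 : 0 < enorm x by rewrite lt_neqAle enorm_ge0 eq_sym enorm_eq0 x0.
have [M M0 SM] := C1c_bounded C1f.
(* Beyond r = L the ray has left S. *)
pose L := M / enorm x; have L0 : 0 < L by rewrite divr_gt0.
have out r : L <= r -> ~ S (r *: x).
  move=> Lr /SM; rewrite enormZ ?(le_trans (ltW L0))// ltNge; apply/negP.
  by rewrite negbK -ler_pdivrMr.
pose u (r : R) := \sum_i x 0 i * partial i f (r *: x).
have cu : continuous u.
  apply: (@continuous_sum R R N (fun i s => x 0 i * partial i f (s *: x))) => i
    r.
  apply: cvgM; first exact: cvg_cst.
  apply: (@continuous_comp _ _ _ (fun s : R => s *: x)).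
    exact: scalel_continuous.
  exact: cf.
have du r := @is_derive_ray R N f x r df.
have cF : continuous (fun r : R => f (r *: x)).
  move=> r; apply: (@differentiable_continuous _ R^o R^o);
    apply/derivable1_diffP.
  by have [] := du r.
transitivity (\int[leb]_(r in `[0%R, L]) (u r)%:E)%E; last first.
  rewrite (@continuous_FTC2 R u (fun r => f (r *: x)))//.
  - by rewrite scale0r; case: C1f => _ _ _ -> //; [rewrite sub0e|exact: out].
  - exact: continuous_subspaceT.
  - split; first by move=> r _; have [] := du r.
      exact/cvg_at_right_filter/cF.
    exact/cvg_at_left_filter/cF.
  - by move=> r _; rewrite derive1E; have [_ ->] := du r.
rewrite -integral_itv_obnd_cbnd; last first.
  by apply/measurable_EFinP/measurable_funTS; exact: continuous_measurable_fun.
rewrite [RHS]integral_mkcond; apply: eq_integral => r _; rewrite patchE.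
rewrite /polar_integrand /= x1 /= mem_setE in_itv /=.
case: (ltP 0 r) => //= r0.
case: leP => [rL|Lr]; last by rewrite euler_field_out ?mul0r//; apply: out;
  exact: ltW.
congr EFin; rewrite /euler_field mulr_suml; apply: eq_bigr => i _.
by rewrite mxE mulrC !mulrA mulVf ?mul1r// gt_eqF.
Qed.

Lemma euler_field_integrable :
  lam.-integrable setT (fun t => (euler_field f (rt t) / enorm (rt t) ^+ N)%:E).
Proof.
have [C fC] := euler_field_le; have [M M0 SM] := C1c_bounded C1f.
apply: (kernel_integrable M0 _ fC).
  by apply: continuous_row_measurable; exact: euler_field_continuous.
by move=> x Mx; apply: euler_field_out => /SM; rewrite ltNge ltW.
Qed.

Lemma polar_integrable (h : U -> R) : row_measurable h -> (forall x,
  0 <= h x) ->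
  h 0 = 0 -> (forall x, h x <= `|euler_field f x|) ->
  (\int[lam]_t (h (rt t) / enorm (rt t) ^+ N)%:E < +oo)%E.
Proof.
move=> mh h0 h00 hf; have /integrableP[_] := euler_field_integrable.
apply: le_lt_trans; apply: ge0_le_integral => //.
- by move=> t _; rewrite lee_fin divr_ge0// exprn_ge0// enorm_ge0.
- by apply/measurable_EFinP; exact: row_measurable_kernel.
- apply: measurableT_comp => //; apply/measurable_EFinP.
  apply: row_measurable_kernel; apply: continuous_row_measurable.
  exact: euler_field_continuous.
- move=> t _; rewrite abse_EFin lee_fin normrM ler_pM//.
    by rewrite invr_ge0 exprn_ge0// enorm_ge0.
  by rewrite ger0_norm// invr_ge0 exprn_ge0// enorm_ge0.
Qed.

(** Finiteness is transported through [polar] from the integrable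
    euler_field f / |x|^N. *)
Lemma radial_integrable_le (h : U -> R) : row_measurable h -> (forall x,
  0 <= h x) ->
  h 0 = 0 -> (forall x, h x <= `|euler_field f x|) ->
  lam.-integrable setT (fun t => \int[leb]_r (polar_integrand h (t, r))%:E)%E.
Proof.
move=> mh h0 h00 hf; apply/integrableP; split.
  exact: measurable_radial_integral.
under eq_integral => t _.
  rewrite gee0_abs; last by apply: integral_ge0 => r _;
    rewrite lee_fin polar_integrand_ge0.
  over.
have := polar_integrable mh h0 h00 hf; rewrite polar//.
by case: (integral _ _ _) => [r _||]; rewrite ?ltry// gt0_muley// lte_fin.
Qed.

(** The formula [polar] is for nonnegative functions, so it is applied to the
    positive and negative parts of the Euler field; the two integrals over the
    unit ball are finite, and their difference is the integral of the constant
    - f(0) of [integral_ray], the null set t = 0 apart. *)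
Lemma euler_identity :
  (\int[lam]_t (euler_field f (rt t) / enorm (rt t) ^+ N)%:E =
   (- (N%:R * unit_ball_vol R N * f 0))%:E)%E.
Proof.
set h := euler_field f.
have mh : row_measurable h.
  by apply: continuous_row_measurable; exact: euler_field_continuous.
have h00 : h 0 = 0 by rewrite /h /euler_field big1// => i _; rewrite mxE mul0r.
have mp : row_measurable h^\+ by exact: measurable_funrpos.
have mn : row_measurable h^\- by exact: measurable_funrneg.
have p00 : h^\+ 0 = 0 by rewrite /funrpos h00 maxxx.
have n00 : h^\- 0 = 0 by rewrite /funrneg h00 oppr0 maxxx.
have p0 := funrpos_ge0 h. have n0 := funrneg_ge0 h.
have ple x : h^\+ x <= `|h x| by rewrite /funrpos ge_max ler_norm normr_ge0.
have nle x : h^\- x <= `|h x| by rewrite /funrneg ge_max normr_ge0 -normrN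
  ler_norm.
have maxM (a c : R) : 0 <= c -> Num.max (a * c) 0 = Num.max a 0 * c.
  by move=> c0; rewrite maxr_pMl// mul0r.
have gp : (fun t => (h (rt t) / enorm (rt t) ^+ N)%:E)^\+%E =
    fun t => (h^\+ (rt t) / enorm (rt t) ^+ N)%:E.
  rewrite (funerpos (fun t => h (rt t) / enorm (rt t) ^+ N)).
  apply/funext => t /=; rewrite /funrpos maxM//.
  by rewrite invr_ge0 exprn_ge0// enorm_ge0.
have gn : (fun t => (h (rt t) / enorm (rt t) ^+ N)%:E)^\-%E =
    fun t => (h^\- (rt t) / enorm (rt t) ^+ N)%:E.
  rewrite (funerneg (fun t => h (rt t) / enorm (rt t) ^+ N)).
  apply/funext => t /=; rewrite /funrneg -mulNr maxM//.
  by rewrite invr_ge0 exprn_ge0// enorm_ge0.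
rewrite integralE gp gn !polar//.
have ip := radial_integrable_le mp p0 p00 ple.
have iq := radial_integrable_le mn n0 n00 nle.
rewrite -muleBr//; last by apply: fin_num_adde_defr; exact: integrable_fin_num.
rewrite -integralB//.
have PQ t : (\int[leb]_r (polar_integrand h^\+ (t, r))%:E -
    \int[leb]_r (polar_integrand h^\- (t, r))%:E =
    \int[leb]_r (polar_integrand h (t, r))%:E)%E.
  rewrite [RHS]integralE (funerpos (fun r => polar_integrand h (t, r))).
  rewrite (funerneg (fun r => polar_integrand h (t, r))).
  congr (_ - _)%E; apply: eq_integral => r _ /=; congr EFin.
    rewrite /polar_integrand /funrpos /=; case: ifPn => [/andP[_ r0]|_].
      by rewrite maxM// invr_ge0 ltW.
    by rewrite maxxx.
  rewrite /polar_integrand /funrneg /=; case: ifPn => [/andP[_ r0]|_].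
    by rewrite -mulNr maxM// invr_ge0 ltW.
  by rewrite oppr0 maxxx.
have -> : (\int[lam]_t (\int[leb]_r (polar_integrand h^\+ (t, r))%:E -
    \int[leb]_r (polar_integrand h^\- (t, r))%:E) =
    \int[lam]_(t in [set t | (enorm (rt t) < 1)%R]) cst (- f 0)%:E t)%E.
  rewrite [RHS]integral_mkcond; apply: ae_eq_integral => //.
  - by apply: emeasurable_funB; exact: measurable_radial_integral.
  - apply/(measurable_restrictT _ _).1 => //; exact: measurable_row_ball.
  exists [set t | rt t = 0]; split => //=.
  - by rewrite origin_cube; exact: measurable_cube.
  - exact: lebesgue_origin.
  move=> t /= ; apply: contra_notP => t0 _; rewrite PQ patchE.
  case: ifPn => t1; last first.
    apply: integral0_eq => r _; rewrite /polar_integrand /=.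
    by move: t1; rewrite notin_setE /= => /negP /negbTE ->.
  by rewrite integral_ray//; [exact/eqP|move: t1; rewrite inE].
rewrite integral_cst; last exact: measurable_row_ball.
rewrite [X in (_ * (_ * X))%E]lebesgue_unit_ball -!EFinM; congr EFin.
by rewrite mulNr mulrN [f 0 * _]mulrC mulrA.
Qed.

End Euler.

(** * The integral of a partial derivative vanishes *)

Section Translation.
Context {R : realType} {N : nat}.
Local Notation U := 'rV[R]_N.
Local Notation mR := (measurableTypeR R).
Local Notation rt := (@row_of_tuple R N).
Local Notation lam := (@lebesgue_tuple R N).

Lemma integral_translate (g : U -> R) (v : U) : row_measurable g ->
  (\int[lam]_t (g (v + rt t))%:E = \int[lam]_t (g (rt t))%:E)%E.
Proof.
move=> mg.
rewrite [LHS]integralE (funerpos (fun t => g (v + rt t))) (funerneg (fun t => g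
  (v + rt t))).
rewrite [RHS]integralE (funerpos (fun t => g (rt t))) (funerneg (fun t => g (rt
  t))).
have mp : row_measurable g^\+ by exact: measurable_funrpos.
have mn : row_measurable g^\- by exact: measurable_funrneg.
have aff (f : U -> R) : row_measurable f -> (forall x, 0 <= f x) ->
    (\int[lam]_t (f (v + rt t))%:E = \int[lam]_t (f (rt t))%:E)%E.
  move=> mf f0; rewrite [RHS](ge0_integral_row_affine v ltr01 mf f0) expr1n
    mul1e.
  by apply: eq_integral => t _; rewrite scale1r.
congr (_ - _)%E; first exact: (aff _ mp (funrpos_ge0 _)).
exact: (aff _ mn (funrneg_ge0 _)).
Qed.

Lemma cube_integrable (M : R) :
  lam.-integrable setT (fun t => (\1_(@cube R N `|M|) t)%:E).
Proof.
apply/integrableP; split.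
  by apply/measurable_EFinP; apply: measurable_indic; exact: measurable_cube.
under eq_integral do rewrite gee0_abs ?lee_fin//.
rewrite integral_indic//; last exact: measurable_cube.
have lty : (lam (cube `|M|) < +oo)%E by rewrite lebesgue_cube// ltry.
by rewrite setIT; exact: lty.
Qed.

Lemma bounded_cube_integrable (f : U -> R) (M C : R) : row_measurable f ->
  (forall x, `|f x| <= C) -> (forall t, ~ cube M t -> f (rt t) = 0) ->
  lam.-integrable setT (fun t => (f (rt t))%:E).
Proof.
move=> mf fC fM.
have iM := cube_integrable M.
apply: (le_integrable _ _ _ (integrableZl _ C iM)) => //.
  exact/measurable_EFinP.
move=> t _; rewrite -EFinM !abse_EFin lee_fin indicE.
have [tM|tM] := pselect (cube M t); last by rewrite fM// normr0.
rewrite mem_set ?mulr1; first by rewrite (le_trans (fC _))// ler_norm.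
by move=> i; rewrite (le_trans (tM i))// ler_norm.
Qed.

Lemma C1c_cube (S : set U) f : C1c S f -> exists M : R, 0 < M /\ forall t,
  S (rt t) -> cube M t.
Proof.
move=> /C1c_bounded[M M0 SM]; exists M; split => // t /SM tM.
exact: row_ball_sub_cube.
Qed.

Lemma C1c_row_measurable (S : set U) f : C1c S f -> row_measurable f.
Proof.
move=> [_ df _ _]; apply: continuous_row_measurable => x.
exact: (differentiable_continuous (df x)).
Qed.

Lemma C1c_partial_bounded (S : set U) f i : C1c S f ->
  exists2 C, 0 <= C & forall x, `|partial i f x| <= C.
Proof.
move=> Cf; case: (Cf) => cS _ cf _.
apply: (@continuous_support_bounded R N S) => // x; exact: C1c_partial0.
Qed.

Lemma C1c_integrable (S : set U) f : C1c S f ->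
  lam.-integrable setT (fun t => (f (rt t))%:E).
Proof.
move=> Cf; have [M [M0 SM]] := C1c_cube Cf.
have [C C0 fC] : exists2 C, 0 <= C & forall x, `|f x| <= C.
  case: Cf => cS df _ f0; apply: (@continuous_support_bounded R N S) => // x.
  exact: (differentiable_continuous (df x)).
apply: (bounded_cube_integrable (C1c_row_measurable Cf) fC (M := M)) => t tM.
by case: Cf => _ _ _; apply => /SM.
Qed.

Lemma C1c_partial_integrable (S : set U) f i : C1c S f ->
  lam.-integrable setT (fun t => (partial i f (rt t))%:E).
Proof.
move=> Cf; have [M [M0 SM]] := C1c_cube Cf;
  have [C C0 fC] := C1c_partial_bounded i Cf.
apply: (bounded_cube_integrable _ fC (M := M)) => [|t tM].
  by apply: continuous_row_measurable; case: Cf.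
by apply: (C1c_partial0 _ Cf) => /SM.
Qed.

(** The mean value theorem on the segment from x to x + h e_i. *)
Lemma C1c_quotient_le (S : set U) f i (C h : R) x : C1c S f ->
  (forall x, `|partial i f x| <= C) -> 0 < h ->
  `|h^-1 * (f (h *: delta_mx 0 i + x) - f x)| <= C.
Proof.
move=> [_ df _ _] fC h0; pose v : U := delta_mx 0 i.
have du (r : R) : is_derive r 1 (fun r : R => f (r *: v + x) : R^o) (partial i f
  (r *: v + x)).
  exact: is_derive_line.
have cu : {within `[0, h], continuous (fun r : R => f (r *: v + x))}.
  apply: continuous_subspaceT => r.
  apply: (@differentiable_continuous _ R^o R^o); apply/derivable1_diffP.
  by have [] := du r.
have [c _] := MVT h0 (fun r _ => du r) cu.
by rewrite scale0r add0r subr0 => ->; rewrite mulrCA mulVf ?mulr1 ?gt_eqF.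
Qed.

Lemma cvg_partial (f : U -> R) i x : differentiable (f : U -> R^o) x ->
  (fun k : nat => k.+1%:R * (f (k.+1%:R^-1 *: delta_mx 0 i + x) - f x)) @ \oo
    --> partial i f x.
Proof.
move=> df; have dv : derivable (f : U ->
  R^o) x (delta_mx 0 i) by exact: diff_derivable.
have h0 : (fun k : nat => k.+1%:R^-1 : R) @ \oo --> 0^'.
  move=> A [e /= e0 eA].
  have := @cvg_harmonic R; move/cvgr0Pnorm_lt => /(_ e e0) [n _ nP].
  exists n => // k /= nk; apply: eA => /=; first by rewrite sub0r normrN;
    exact: nP.
  by rewrite invr_eq0 pnatr_eq0.
have := cvg_comp _ _ h0 dv.
by apply: cvg_trans; apply: near_eq_cvg; near=> k; rewrite /= invrK.
Unshelve. all: by end_near. Qed.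

Lemma row_measurable_translate (f : U -> R) (v : U) : row_measurable f ->
  row_measurable (fun x => f (v + x)).
Proof.
move=> /(@row_measurable_affine R N f v 1).
by congr row_measurable; apply/funext => x; rewrite scale1r.
Qed.

(** The difference quotients of f in direction i have integral 0 by translation
    invariance; for steps at most 1 they are bounded and supported in a common
    cube, so that dominated convergence applies. *)
Lemma integral_partial0 (S : set U) f i : C1c S f ->
  (\int[lam]_t (partial i f (rt t))%:E = 0)%E.
Proof.
move=> Cf; case: (Cf) => _ df cf f0.
have [M M0 SM] := C1c_bounded Cf; have [C C0 fC] := C1c_partial_bounded i Cf.
pose v (k : nat) : U := k.+1%:R^-1 *: delta_mx 0 i.
pose D k x := k.+1%:R * (f (v k + x) - f x).
have vM k t : ~ cube (M + 1) t -> f (v k + rt t) = 0.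
  move=> tM; apply: f0 => /SM Sx; apply: tM => j.
  have := le_lt_trans (coord_le_enorm (v k + rt t) j) Sx; rewrite !mxE => h.
  rewrite -[tnth t j](addKr (k.+1%:R^-1 * ((0 == 0 :> 'I_1) && (j == i))%:R))
    addrC.
  rewrite (le_trans (ler_normB _ _))// lerD ?(ltW h)//.
  rewrite normrM ger0_norm ?invr_ge0// -[leRHS]mulr1 ler_pM// ?invr_ge0//.
    by rewrite invf_le1// ler1n.
  by case: (_ && _); rewrite ?normr1 ?normr0.
have mf := C1c_row_measurable Cf.
have mv k : row_measurable (fun x => f (v k + x)) by exact:
  row_measurable_translate.
have mD k : row_measurable (D k).
  by apply: measurable_funM => //; exact: (measurable_funB (mv k) mf).
have DC k x : `|D k x| <= C.
  have := @C1c_quotient_le S f i C k.+1%:R^-1 x Cf fC.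
  by rewrite invrK invr_gt0 ltr0n; apply.
have fM t : ~ cube (M + 1) t -> f (rt t) = 0.
  move=> tM; apply: f0 => /SM Sx; apply: tM; apply: row_ball_sub_cube => /=.
  by rewrite (lt_trans Sx)// ltrDl.
have DM k t : ~ cube (M + 1) t -> D k (rt t) = 0.
  by move=> tM; rewrite /D vM// fM// subr0 mulr0.
have [Cb Cb0 fCb] : exists2 C, 0 <= C & forall x, `|f x| <= C.
  case: (Cf) => cS _ _ _; apply: (@continuous_support_bounded R N S) => // x.
  exact: (differentiable_continuous (df x)).
have D0 k : (\int[lam]_t (D k (rt t))%:E = 0)%E.
  rewrite /D; under eq_integral do rewrite EFinM.
  have iv : lam.-integrable setT (fun t => (f (v k + rt t))%:E).
    apply: (@bounded_cube_integrable (fun x => f (v k + x)) (M + 1) Cb) => //;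
      exact: vM.
  have iF := C1c_integrable Cf.
  rewrite integralZl//; last first.
    by under eq_fun do rewrite EFinB; exact: integrableB.
  by under eq_integral do rewrite EFinB;
    rewrite integralB// integral_translate// subee ?mule0// integrable_fin_num.
have iC : lam.-integrable setT (fun t => (C%:E * (\1_(@cube R N (M + 1))
  t)%:E))%E.
  apply: integrableZl => //; rewrite -[M + 1]ger0_norm ?addr_ge0 1?ltW//.
  exact: cube_integrable.
have [] := @dominated_convergence _ _ R lam setT measurableT
  (fun k t => (D k (rt t))%:E) (fun t => (partial i f (rt t))%:E)
  (fun t => C%:E * (\1_(@cube R N (M + 1)) t)%:E)%E.
- by move=> k; apply/measurable_EFinP; exact: mD.
- by apply/measurable_EFinP; exact: continuous_row_measurable.
- apply: aeW => t _; apply: cvg_EFin; first exact: nearW.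
  exact: cvg_partial.
- exact: iC.
- apply: aeW => t k _; rewrite -EFinM abse_EFin lee_fin indicE.
  have [tM|tM] := pselect (cube (M + 1) t);
    last by rewrite DM// normr0 memNset// mulr0.
  by rewrite mem_set// mulr1.
move=> _ _; under eq_fun do rewrite D0.
by move=> /cvg_lim <- //; rewrite lim_cst.
Qed.

End Translation.

(** * The rotation identity: x / |x|^N is curl free *)

Section Rotation.
Context {R : realType} {d : nat}.
Local Notation N := d.+1.
Local Notation U := 'rV[R]_N.
Local Notation mR := (measurableTypeR R).
Local Notation rt := (@row_of_tuple R N).
Local Notation lam := (@lebesgue_tuple R N).

Definition sqn (x : U) : R := \sum_i x 0 i ^+ 2.

Lemma sqn_ge0 x : 0 <= sqn x. Proof. by apply: sumr_ge0 => i _;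
  exact: sqr_ge0. Qed.

Lemma is_derive_coord (x : U) i j :
  is_derive x (delta_mx 0 i) (fun y : U => y 0 j : R^o) (j == i)%:R.
Proof.
apply: DeriveDef; first exact/diff_derivable/differentiable_coord.
rewrite /derive (_ : (fun h : R => _) = fun h => h^-1 * (h * (j == i)%:R));
  last first.
  by apply/funext => h; rewrite /= !mxE eqxx /= addrK.
apply: cvg_lim => //; apply: (@cvg_trans _ (cst (j == i)%:R @ (0 : R)^')).
  apply: near_eq_cvg; near=> h; rewrite mulrA mulVf ?mul1r//.
  by near: h; exact: nbhs_dnbhs_neq.
exact: cvg_cst.
Unshelve. all: by end_near. Qed.

Lemma partial_sqn i x : partial i sqn x = 2 * x 0 i.
Proof.
rewrite /partial.
have -> : sqn = \sum_(j < N) ((fun y : U => y 0 j : R^o) ^+ 2).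
  by apply/funext => y; rewrite fct_sumE; apply: eq_bigr => j _;
    rewrite exprfctE.
have h j : is_derive x (delta_mx 0 i) ((fun y : U => y 0 j : R^o) ^+ 2)
    ((2%:R * x 0 j ^+ 1) *: ((j == i)%:R : R^o)).
  by apply: is_deriveX; exact: is_derive_coord.
rewrite derive_sum => [|j]; last by have [] := h j.
under eq_bigr => j _ do rewrite (@derive_val _ _ _ _ _ _ _ (h j)).
rewrite (bigD1 i)//= eqxx expr1 big1 => [|j ji];
  last by rewrite (negbTE ji) scaler0.
by rewrite addr0 /GRing.scale /= mulr1.
Qed.

(** The value reg e |x|^2 is (|x|^2 + e)^(-N/2), which is smooth in x for e > 0
    and, for x != 0, increases to |x|^-N as e decreases to 0. *)
Definition reg (e : R) (s : R) : R := (Num.sqrt (s + e) ^+ N)^-1.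
(** The derivative of [reg], in the form that the chain rule produces. *)
Definition dreg (e : R) (s : R) : R :=
  - (Num.sqrt (s + e) ^+ N) ^- 2 * ((N%:R * Num.sqrt (s + e) ^+ d) * (2 *
    Num.sqrt (s + e))^-1).

Lemma is_derive_reg (e s : R) : 0 < s + e ->
  is_derive s (1 : R) (reg e) (dreg e s).
Proof.
move=> se0; have r0 : Num.sqrt (s + e) ^+ N != 0 by rewrite expf_neq0// gt_eqF//
  sqrtr_gt0.
have d1 : is_derive s (1 : R) (fun s : R => s + e) 1.
  rewrite -[X in is_derive _ _ _ X]addr0; apply: is_deriveD.
have d2 : is_derive s (1 : R) (fun s : R => Num.sqrt (s + e)) (2 * Num.sqrt (s +
  e))^-1.
  rewrite -[X in is_derive _ _ _ X]mulr1.
  apply: (@is_derive1_comp _ Num.sqrt (fun s : R => s + e) s _ _ _ d1).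
  exact: is_derive1_sqrt.
have d3 : is_derive s (1 : R) ((fun s : R => Num.sqrt (s + e)) ^+ N)
   ((N%:R * Num.sqrt (s + e) ^+ d) *: (2 * Num.sqrt (s + e))^-1).
  exact: is_deriveX.
have := @is_deriveV R ((fun s : R => Num.sqrt (s + e)) ^+ N) s _ 1 _ d3.
rewrite exprfctE; exact.
Qed.

Lemma partial_reg e i x : 0 < e ->
  partial i (reg e \o sqn) x = 2 * x 0 i * dreg e (sqn x).
Proof.
move=> e0; have se0 : 0 < sqn x + e by rewrite ltr_wpDl// sqn_ge0.
have [dr rE] := is_derive_reg se0.
have ds : differentiable sqn x by exact: sqr_enorm_differentiable.
have dr' : differentiable (reg e : R -> R^o) (sqn x) by exact/derivable1_diffP.
rewrite /partial deriveE; last exact: (differentiable_comp ds dr').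
rewrite (diff_comp ds dr') /= -(deriveE _ ds).
have -> : 'D_(delta_mx 0 i) sqn x = 2 * x 0 i by exact: partial_sqn.
by rewrite deriv1E//= derive1E rE.
Qed.

Lemma reg_differentiable e x : 0 < e -> differentiable (reg e \o sqn : U ->
  R^o) x.
Proof.
move=> e0; have se0 : 0 < sqn x + e by rewrite ltr_wpDl// sqn_ge0.
have [dr rE] := is_derive_reg se0.
apply: differentiable_comp; first exact: sqr_enorm_differentiable.
exact/derivable1_diffP.
Qed.

Lemma dreg_continuous (e s : R) : 0 < s + e -> {for s, continuous (dreg e)}.
Proof.
move=> se0; have r0 : Num.sqrt (s + e) != 0 by rewrite gt_eqF// sqrtr_gt0.
have cr : {for s, continuous (fun s : R => Num.sqrt (s + e))}.
  apply: (@continuous_comp _ _ _ (fun s : R => s + e) Num.sqrt).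
    by apply: cvgD; [exact: cvg_id|exact: cvg_cst].
  exact: sqrt_continuous.
have cX n : {for s, continuous (fun s : R => Num.sqrt (s + e) ^+ n)}.
  apply: (@continuous_comp _ _ _ (fun s : R => Num.sqrt (s + e)) (fun x => x ^+
    n)) => //.
  exact: exprn_continuous.
apply: cvgM.
  apply: cvgN; apply: cvgV; first by rewrite !expf_neq0.
  apply: (@continuous_comp _ _ _ (fun s : R => Num.sqrt (s + e) ^+ N) (fun x =>
    x ^+ 2)) => //.
  exact: exprn_continuous.
apply: cvgM; first by apply: cvgM; [exact: cvg_cst|exact: cX].
apply: cvgV; first by rewrite mulf_neq0// pnatr_eq0.
by apply: cvgM; [exact: cvg_cst|exact: cr].
Qed.

Lemma dreg_sqn_continuous e : 0 < e -> continuous (dreg e \o sqn).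
Proof.
move=> e0 x; apply: continuous_comp.
  exact/differentiable_continuous/sqr_enorm_differentiable.
by apply: dreg_continuous; rewrite ltr_wpDl// sqn_ge0.
Qed.

Section Cutoff.
Variables (S : set U) (f : U -> R) (e : R) (a b : 'I_N).
Hypotheses (C1f : C1c S f) (e0 : 0 < e) (ab : a != b).

Let df x : differentiable (f : U -> R^o) x. Proof. by case: C1f. Qed.
Let K := reg e \o sqn.
Let dK x : differentiable (K : U ->
  R^o) x. Proof. exact: reg_differentiable. Qed.

Let partialM (g h : U -> R) i x : differentiable (g : U -> R^o) x ->
  differentiable (h : U -> R^o) x ->
  partial i (fun x => g x * h x) x = g x * partial i h x + h x * partial i g x.
Proof.
by move=> dg dh; rewrite /partial (@deriveM _ _ g h)//; exact: diff_derivable.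
Qed.

Let partialF i c x : partial i (fun x => x 0 c * (K x * f x)) x =
  x 0 c * (K x * partial i f x + f x * (2 * x 0 i * dreg e (sqn x))) +
  K x * f x * (c == i)%:R.
Proof.
rewrite partialM; [|exact: differentiable_coord|exact: differentiableM].
rewrite partialM// partial_reg//; congr (_ + _ * _).
by rewrite /partial; have [_ ->] := is_derive_coord x i c.
Qed.

Lemma C1c_cutoff c : C1c S (fun x => x 0 c * (K x * f x)).
Proof.
case: C1f => cS _ cf f0; split => //.
- move=> x; apply: (@differentiableM _ _ (fun x : U => x 0 c) (fun x => K x * f
  x)).
    exact: differentiable_coord.
  exact: differentiableM.
- move=> i.
  rewrite (_ : partial i _ = fun x => x 0 c * (K x * partial i f x + f x * (2 *
    x 0 i * dreg e (sqn x))) +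
  K x * f x * (c == i)%:R); last by apply/funext => x; exact: partialF.
  have cK : continuous K by move=> x; exact: (differentiable_continuous (dK x)).
  have cf' : continuous f by move=> x;
    exact: (differentiable_continuous (df x)).
  have cc j : continuous (fun x : U => x 0 j) by exact: coord_continuous.
  have cM (g h : U -> R) : continuous g -> continuous h ->
    continuous (fun x => g x * h x).
    by move=> cg ch x; apply: (@continuousM R U g h); [exact: cg|exact: ch].
  have cD (g h : U -> R) : continuous g -> continuous h ->
    continuous (fun x => g x + h x).
    by move=> cg ch x; apply: (@continuousD R R U g h); [exact: cg|exact: ch].
  have cC (k : R) : continuous (fun x : U => k) by exact: cst_continuous.
  apply: (cD (fun x => x 0 c * (K x * partial i f x + f x * (2 * x 0 i * dreg e
    (sqn x))))).
    apply: (cM (fun x => x 0 c)) => //.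
    apply: (cD (fun x => K x * partial i f x)); first exact: cM.
    apply: (cM f) => //; apply: (cM (fun x => 2 * x 0 i)); first exact: cM.
    exact: dreg_sqn_continuous.
  by apply: (cM (fun x => K x * f x)) => //; exact: cM.
- by move=> x Sx; rewrite f0// !mulr0.
Qed.

(** With K radial, the field x_b D_a - x_a D_b annihilates K; hence the integrand
    is D_a (x_b K f) - D_b (x_a K f), both terms of which integrate to 0. *)
Lemma integral_reg_rotation :
  (\int[lam]_t (K (rt t) * (rt t 0 b * partial a f (rt t) - rt t 0 a * partial b
    f (rt t)))%:E = 0)%E.
Proof.
pose F (c : 'I_N) (x : U) : R := x 0 c * (K x * f x).
transitivity (\int[lam]_t ((partial a (F b) (rt t))%:E - (partial b (F a) (rt
  t))%:E))%E.
  apply: eq_integral => t _; rewrite -EFinB !partialF (negbTE ab) eq_sym (negbTE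
    ab).
  by congr EFin; ring.
rewrite integralB//; [|exact: (C1c_partial_integrable a (C1c_cutoff b))|exact:
  (C1c_partial_integrable b (C1c_cutoff a))].
by rewrite (integral_partial0 a (C1c_cutoff b)) (integral_partial0 b (C1c_cutoff
  a)) sube0.
Qed.

End Cutoff.

(** Regularized kernels are dominated by |x|^-N, and the numerator vanishes at
    the origin, so convergence is pointwise everywhere. *)
Lemma rotation_identity (S : set U) (f : U -> R) (a b : 'I_N) : C1c S f ->
  a != b ->
  (\int[lam]_t ((rt t 0 b * partial a f (rt t) - rt t 0 a * partial b f (rt t))
    /
     enorm (rt t) ^+ N)%:E = 0)%E.
Proof.
move=> Cf ab; pose w (x : U) := x 0 b * partial a f x - x 0 a * partial b f x.
have mw : row_measurable w.
  have mc c i : row_measurable (fun x => x 0 c * partial i f x).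
    apply: (@measurable_funM _ _ R setT (fun t => rt t 0 c) (partial i f \o
      rt)).
      apply: (@continuous_row_measurable R N (fun x => x 0 c));
        exact: coord_continuous.
    by apply: continuous_row_measurable; case: Cf.
  exact: (measurable_funB (mc b a) (mc a b)).
(* At the origin w vanishes, and with it the regularized and limit integrands. *)
have w0 x : sqn x = 0 -> w x = 0.
  move=> /eqP; rewrite /sqn -sqr_enorm sqrf_eq0 enorm_eq0 => /eqP ->.
  by rewrite /w !mxE !mul0r subr0.
have [Ca _ fCa] := C1c_partial_bounded a Cf;
  have [Cb _ fCb] := C1c_partial_bounded b Cf.
have wC x : `|w x| <= (Ca + Cb) * enorm x.
  rewrite (le_trans (ler_normB _ _))// !normrM mulrDl lerD//.
    by rewrite mulrC ler_pM// coord_le_enorm.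
  by rewrite mulrC ler_pM// coord_le_enorm.
have [M M0 SM] := C1c_bounded Cf.
have iw : lam.-integrable setT (fun t => (w (rt t) / enorm (rt t) ^+ N)%:E).
  apply: (kernel_integrable M0 mw wC) => x Mx.
  have Sx : ~ S x by move=> /SM; rewrite ltNge ltW.
  by rewrite /w !(C1c_partial0 _ Cf Sx) !mulr0 subr0.
pose K (k : nat) := reg k.+1%:R^-1 \o sqn.
have k0 k : 0 < k.+1%:R^-1 :> R by rewrite invr_gt0.
have [] := @dominated_convergence _ _ R lam setT measurableT
  (fun k t => (K k (rt t) * w (rt t))%:E) (fun t => (w (rt t) / enorm (rt t) ^+
    N)%:E)
  (fun t => `| (w (rt t) / enorm (rt t) ^+ N)%:E |)%E.
- move=> k; apply/measurable_EFinP; apply: measurable_funM => //.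
  apply: (@continuous_row_measurable R N (K k)) => x.
  exact: (differentiable_continuous (reg_differentiable x (k0 k))).
- exact: measurable_int iw.
- apply: aeW => t _; apply: cvg_EFin; first exact: nearW.
  have [/w0 x0|x0] := eqVneq (sqn (rt t)) 0.
    rewrite (_ : _ \o _ = cst (w (rt t) / enorm (rt t) ^+ N));
      first exact: cvg_cst.
    by apply/funext => k; rewrite /= x0 mulr0 mul0r.
  have q0 : 0 < sqn (rt t) + 0 by rewrite addr0 lt_neqAle sqn_ge0 eq_sym x0.
  rewrite mulrC; apply: (@cvgM _ _ _ _ (fun k => K k (rt t)) (cst (w (rt t)))).
    have -> : (enorm (rt t) ^+ N)^-1 = reg 0 (sqn (rt t) + 0).
      by rewrite /reg !addr0.
    rewrite (_ : (fun k => _) = fun k : nat => reg 0 (sqn (rt t) + k.+1%:R^-1));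
      last first.
      by apply/funext => k; rewrite /K /reg /= addr0.
    have cr : {for (sqn (rt t) + 0), continuous (reg 0)}.
      apply: (@differentiable_continuous _ R^o R^o); apply/derivable1_diffP.
      by have [] := @is_derive_reg 0 (sqn (rt t) + 0) (etrans (congr1 _ (addr0
        _)) q0).
    apply: (@cvg_comp _ _ _ (fun k : nat => sqn (rt t) + k.+1%:R^-1) (reg 0) _ _
      _ _ cr).
    by apply: cvgD; [exact: cvg_cst|exact: cvg_harmonic].
  exact: cvg_cst.
- exact: integrable_abse.
- apply: aeW => t k _; rewrite !abse_EFin lee_fin mulrC !normrM.
  have [/w0 ->|x0] := eqVneq (sqn (rt t)) 0; first by rewrite normr0 !mul0r.
  have q0 : 0 < sqn (rt t) by rewrite lt_neqAle sqn_ge0 eq_sym x0.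
  have qk : 0 < sqn (rt t) + k.+1%:R^-1 by rewrite addr_gt0.
  rewrite ler_wpM2l// !ger0_norm ?invr_ge0 ?exprn_ge0 ?sqrtr_ge0//.
  rewrite lef_pV2 ?posrE ?exprn_gt0 ?sqrtr_gt0// lerXn2r ?nnegrE ?sqrtr_ge0//.
  by rewrite ler_wsqrtr// lerDl ltW.
move=> _ _; under eq_fun do rewrite (integral_reg_rotation Cf (k0 _) ab).
by move=> /cvg_lim <- //; rewrite lim_cst.
Qed.

End Rotation.

(** * Moments of the gradient and algebra-valued integrals *)

Section Moments.
Context {R : realType} {d : nat}.
Local Notation N := d.+1.
Local Notation U := 'rV[R]_N.
Local Notation mR := (measurableTypeR R).
Local Notation rt := (@row_of_tuple R N).
Local Notation lam := (@lebesgue_tuple R N).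

(** Minus the distribution D_j (x_i / |x|^N) evaluated at f. *)
Definition moment (f : U -> R) (i j : 'I_N) : R :=
  \int[lam]_t (rt t 0 i * partial j f (rt t) / enorm (rt t) ^+ N).

Lemma test_function_C1c (f : U -> R) : test_function f ->
  C1c (closure [set x | f x != 0]) f.
Proof.
move=> [sf cf]; split => // [x|i x|x].
- exact: (sf [::] x).
- exact: (differentiable_continuous (sf [:: i] x)).
- by move=> Sx; apply/eqP; apply: contra_notT Sx => fx; exact: subset_closure.
Qed.

Variables (S : set U) (f : U -> R).
Hypothesis C1f : C1c S f.

Lemma moment_integrable i j :
  lam.-integrable setT (fun t => (rt t 0 i * partial j f (rt t) / enorm (rt t)
    ^+ N)%:E).
Proof.
have [C _ fC] := C1c_partial_bounded j C1f; have [M M0 SM] := C1c_bounded C1f.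
apply: (kernel_integrable (M := M) (C := C) (f := fun x => x 0 i * partial j f
  x)) => //.
- apply: (@measurable_funM _ _ R setT (fun t => rt t 0 i) (partial j f \o rt)).
    apply: (@continuous_row_measurable R N (fun x => x 0 i));
      exact: coord_continuous.
  by apply: continuous_row_measurable; case: C1f.
- by move=> x; rewrite normrM mulrC ler_pM// coord_le_enorm.
- move=> x Mx; rewrite (C1c_partial0 _ C1f) ?mulr0// => /SM.
  by rewrite ltNge ltW.
Qed.

Lemma moment_sym i j : moment f i j = moment f j i.
Proof.
have [->//|ij] := eqVneq i j.
apply/eqP; rewrite -subr_eq0; apply/eqP.
rewrite -[LHS]RintegralB//; [|exact: moment_integrable|exact:
  moment_integrable].
rewrite -[RHS]/(fine 0%E) -(rotation_identity C1f (a := j) (b := i)) 1?eq_sym//.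
by congr fine; apply: eq_integral => t _; rewrite mulrBl.
Qed.

Lemma moment_trace : \sum_i moment f i i = - (N%:R * unit_ball_vol R N * f 0).
Proof.
apply: EFin_inj; rewrite -(euler_identity C1f) -sumEFin.
under [RHS]eq_integral => t _ do rewrite /euler_field mulr_suml -sumEFin.
rewrite integral_sum//; last by move=> i; exact: moment_integrable.
by apply: eq_bigr => i _; rewrite fineK//; apply: integrable_fin_num => //;
  exact: moment_integrable.
Qed.

End Moments.

Section IntegralL.
Context (R : realType) (N : nat) (L : falgType R).
Local Notation U := 'rV[R]_N.
Local Notation rt := (@row_of_tuple R N).
Local Notation lam := (@lebesgue_tuple R N).

Lemma integralL_lincomb (g1 g2 : U -> R) (v1 v2 : L) :
  lam.-integrable setT (fun t => (g1 (rt t))%:E) ->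
  lam.-integrable setT (fun t => (g2 (rt t))%:E) ->
  integralL (fun x => g1 x *: v1 + g2 x *: v2) =
  (\int[lam]_t g1 (rt t)) *: v1 + (\int[lam]_t g2 (rt t)) *: v2.
Proof.
move=> i1 i2; rewrite /integralL.
rewrite {2}(coord_vbasis (memvf v1)) {2}(coord_vbasis (memvf v2)).
rewrite !scaler_sumr -big_split; apply: eq_bigr => i _ /=.
rewrite !scalerA -scalerDl; congr (_ *: _).
rewrite -!RintegralZr// -RintegralD//.
- by apply: eq_Rintegral => t _; rewrite /coordL linearD !linearZ.
- by apply: (eq_integrable _ _ _ _ (integrableZl _ (coord (vbasis {:L}) i v1)
  i1)) => // t _; rewrite -EFinM mulrC.
- by apply: (eq_integrable _ _ _ _ (integrableZl _ (coord (vbasis {:L}) i v2)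
  i2)) => // t _; rewrite -EFinM mulrC.
Qed.

Lemma integralL0 : integralL (fun x : U => 0 : L) = 0.
Proof.
rewrite /integralL big1// => i _; rewrite (_ : Rintegral _ _ _ = 0) ?scale0r//.
rewrite (eq_Rintegral _ (g := cst 0)) ?Rintegral_cst ?mul0r// => t _.
by rewrite /coordL linear0.
Qed.

(** Linear forms in the real coordinates, with values in L. *)
Definition linform (g : U -> L) := exists w : 'I_N -> L, forall x,
  g x = \sum_j x 0 j *: w j.

Lemma linform_sum I (r : seq I) (P : pred I) (g : I -> U -> L) :
  (forall i, linform (g i)) -> linform (fun x => \sum_(i <- r | P i) g i x).
Proof.
move=> hg; elim: r => [|i r [w wE]].
  exists (fun=> 0) => x; rewrite big_nil big1// => j _; exact: scaler0.
have [v vE] := hg i; case Pi : (P i); last first.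
  by exists w => x; rewrite big_cons Pi wE.
exists (fun j => v j + w j) => x; rewrite big_cons Pi wE vE -big_split.
by apply: eq_bigr => j _; rewrite scalerDr.
Qed.

Lemma linformD (f g : U -> L) : linform f -> linform g ->
  linform (fun x => f x + g x).
Proof.
move=> [v vE] [w wE]; exists (fun j => v j + w j) => x.
by rewrite vE wE -big_split; apply: eq_bigr => j _; rewrite scalerDr.
Qed.

Lemma linformZ k (g : U -> L) : linform g -> linform (fun x => k *: g x).
Proof.
move=> [w wE]; exists (fun j => k *: w j) => x.
by rewrite wE scaler_sumr; apply: eq_bigr => j _; rewrite !scalerA mulrC.
Qed.

Lemma linform_coord i v : linform (fun x => x 0 i *: v).
Proof.
exists (fun j => if j == i then v else 0) => x.
by rewrite (bigD1 i)//= eqxx big1 ?addr0// => j /negbTE ->; rewrite scaler0.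
Qed.

End IntegralL.

Lemma linform_locally_integrable (R : realType) (d : nat) (L : falgType R) (c :
  R)
    (g : 'rV[R]_d.+1 -> L) : linform g ->
  locally_integrableL (fun x => (c / enorm x ^+ d.+1) *: g x).
Proof.
move=> [w wE] K cK i.
have [M [M0 KM]] : exists M : R, 0 < M /\ forall x, K x -> enorm x <= M.
  have /compact_bounded [M [_ MK]] : compact (@enorm R d.+1 @` K).
    by apply: continuous_compact => //;
      exact/continuous_subspaceT/enorm_continuous.
  exists (`|M| + 1); split; first by rewrite ltr_wpDl.
  move=> x Kx; rewrite -(ger0_norm (enorm_ge0 x)); apply: MK; last by exists x.
  by rewrite (le_lt_trans (ler_norm M))// ltrDl.
pose b j := c * coordL i (w j).
pose f (x : 'rV[R]_d.+1) := \sum_j x 0 j * b j.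
have fE x : coordL i ((c / enorm x ^+ d.+1) *: g x) = f x / enorm x ^+ d.+1.
  rewrite /coordL linearZ wE linear_sum /= mulrAC /f; congr (_ / _).
  rewrite mulr_sumr; apply: eq_bigr => j _; rewrite linearZ /b /coordL /=.
  by rewrite mulrCA.
have cf : continuous f.
  apply: (@continuous_sum R _ _ (fun j (x : 'rV[R]_d.+1) => x 0 j * b j)) => j
    x.
  apply: (@continuousM R _ (fun x : 'rV[R]_d.+1 => x 0 j) (cst (b j))).
    exact: coord_continuous.
  exact: cst_continuous.
have mK : measurable (@row_of_tuple R d.+1 @^-1` K).
  have oK : open (~` K) by apply: closed_openC; exact: compact_closed.
  by rewrite -[K]setCK preimage_setC; apply: measurableC;
    exact: measurable_open oK.
pose h x := if enorm x <= M then f x else 0.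
apply: (eq_integrable _ (fun t => (h (row_of_tuple t) / enorm (row_of_tuple t)
  ^+ d.+1)%:E)) => //.
  by move=> t; rewrite inE /= => /KM tM; rewrite fE /h tM.
apply: (@integrableS _ _ _ _ setT) => //.
apply: (kernel_integrable (C := \sum_j `|b j|) M0).
- by apply: row_measurable_cutoff; exact: continuous_row_measurable.
- move=> x; rewrite /h; case: ifP => _;
  last by rewrite normr0 mulr_ge0// ?enorm_ge0// sumr_ge0.
  rewrite (le_trans (ler_norm_sum _ _ _))// mulr_suml; apply: ler_sum => j _.
  by rewrite normrM mulrC ler_wpM2l// coord_le_enorm.
- by move=> x Mx; rewrite /h leNgt Mx.
Qed.

(** * Numbering of the coordinates and exterior products *)

Section Blocks.
Context (s : nat -> nat) (r : nat).
Hypothesis sS : forall k, (k < r)%N -> (s k < s k.+1)%N.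

Lemma block_mono a b : (a <= b)%N -> (b <= r)%N -> (s a <= s b)%N.
Proof.
elim: b => [|b IH]; first by rewrite leqn0 => /eqP ->.
rewrite leq_eqVlt => /predU1P[-> //|ab] br.
by rewrite (leq_trans (IH ab (ltnW br)))// ltnW// sS.
Qed.

(** The blocks cut out by the s k are disjoint. *)
Lemma block_uniq k k' i : (k < r)%N -> (k' < r)%N ->
  (s k <= i < s k.+1)%N -> (s k' <= i < s k'.+1)%N -> k = k'.
Proof.
move=> kr kr' /andP[ki ik] /andP[ki' ik']; apply/eqP.
rewrite eqn_leq (leqNgt k k') (leqNgt k' k).
apply/andP; split; apply/negP => lt.
  have := leq_trans ik' (block_mono lt (ltnW kr)); by rewrite ltnNge ki.
have := leq_trans ik (block_mono lt (ltnW kr')); by rewrite ltnNge ki'.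
Qed.

Lemma sum_blocks (V : nmodType) (G : nat -> V) :
  \sum_(k < r) \sum_(s k <= i < s k.+1) G i = \sum_(s 0%N <= i < s r) G i.
Proof.
suff : forall r', (r' <= r)%N ->
    \sum_(k < r') \sum_(s k <= i < s k.+1) G i = \sum_(s 0%N <= i < s r') G i.
  exact.
elim=> [|r' IH] r'r; first by rewrite big_ord0 big_geq.
rewrite big_ord_recr /= IH ?(ltnW r'r)// -big_cat_nat//.
  by rewrite block_mono// ltnW.
exact/ltnW/sS.
Qed.

End Blocks.

Section Coordinates.
Context (n m p q d : nat).
Hypothesis dE : d.+1 = (n * p.+1 + m * q)%N.

Lemma yidx_lt i j : (i < n)%N -> (j < p.+1)%N -> (yidx p i j < n * p.+1)%N.
Proof.
move=> ni pj; rewrite /yidx (@leq_trans (i.+1 * p.+1)) ?leq_mul2r ?ni ?orbT//.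
by rewrite mulSn addnC ltn_add2r.
Qed.

Lemma tidx_lt l k : (l < m)%N -> (k < q)%N -> (tidx n p q l k < d.+1)%N.
Proof.
move=> lm kq; rewrite dE /tidx -addnA ltn_add2l.
rewrite (@leq_trans (l.+1 * q)) ?leq_mul2r ?lm ?orbT//.
by rewrite mulSn addnC ltn_add2r.
Qed.

Lemma val_yco i j : (i < n)%N -> (j < p.+1)%N ->
  yco p d i j = yidx p i j :> nat.
Proof.
move=> ni pj; rewrite /yco inordK// dE (leq_trans (yidx_lt ni pj))//.
exact: leq_addr.
Qed.

Lemma val_tco l k : (l < m)%N -> (k < q)%N ->
  tco n p q d l k = tidx n p q l k :> nat.
Proof. by move=> lm kq; rewrite /tco inordK// tidx_lt. Qed.

Lemma yco_inj i j i' j' : (i < n)%N -> (j < p.+1)%N -> (i' < n)%N ->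
  (j' < p.+1)%N ->
  yco p d i j = yco p d i' j' -> i = i' /\ j = j'.
Proof.
move=> ni pj ni' pj' /(congr1 val); rewrite /= !val_yco// /yidx => h; split.
  have := congr1 (fun x => x %/ p.+1)%N h.
  by rewrite /= !divnMDl// !divn_small// !addn0.
have := congr1 (fun x => x %% p.+1)%N h.
by rewrite /= !modnMDl !modn_small.
Qed.

Lemma tco_inj l k l' k' : (l < m)%N -> (k < q)%N -> (l' < m)%N -> (k' < q)%N ->
  tco n p q d l k = tco n p q d l' k' -> l = l' /\ k = k'.
Proof.
move=> lm kq lm' kq' /(congr1 val); rewrite /= !val_tco// /tidx -!addnA.
move=> /addnI h; have q0 : (0 < q)%N by exact: leq_ltn_trans kq.
split.
  have := congr1 (fun x => x %/ q)%N h.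
  by rewrite /= !divnMDl// !divn_small// !addn0.
have := congr1 (fun x => x %% q)%N h.
by rewrite /= !modnMDl !modn_small.
Qed.

Lemma yco_neq_tco i j l k : (i < n)%N -> (j < p.+1)%N -> (l < m)%N ->
  (k < q)%N ->
  yco p d i j <> tco n p q d l k.
Proof.
move=> ni pj lm kq /(congr1 val); rewrite /= val_yco// val_tco// => h.
have := yidx_lt ni pj; rewrite h /tidx -addnA ltnNge leq_addr//.
Qed.

Lemma sum_nat_mul (V : nmodType) (a b : nat) (G : nat -> V) :
  \sum_(0 <= x < a * b) G x = \sum_(i < a) \sum_(0 <= j < b) G (i * b + j)%N.
Proof.
rewrite big_nat_mul big_mkord; apply: eq_bigr => i _.
by rewrite -{1}[(i * b)%N]add0n mulSn big_addn addnK; apply: eq_bigr => j _;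
  rewrite addnC.
Qed.

(** The groups y_i and theta_l exhaust the coordinates, in this order. *)
Lemma sum_coordinates (V : nmodType) (G : 'I_d.+1 -> V) :
  \sum_x G x = \sum_(i < n) \sum_(0 <= j < p.+1) G (yco p d i j) +
               \sum_(l < m) \sum_(0 <= k < q) G (tco n p q d l k).
Proof.
transitivity (\sum_(0 <= x < d.+1) G (inord x)).
  by rewrite big_mkord; apply: eq_bigr => x _; rewrite inord_val.
rewrite dE (@big_cat_nat _ _ _ (n * p.+1)) ?leq_addr//=; congr (_ + _).
  by rewrite sum_nat_mul.
rewrite -{1}[(n * p.+1)%N]add0n big_addn addKn sum_nat_mul.
by apply: eq_bigr => l _; apply: eq_bigr => k _; rewrite /tco /tidx addnC addnA.
Qed.

End Coordinates.

Section PickTerm.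
Context (V : nmodType).

Lemma sum_pick_ord n (i0 : 'I_n) (F : 'I_n -> V) :
  (forall i, i != i0 -> F i = 0) -> \sum_(i < n) F i = F i0.
Proof. by move=> F0; rewrite (bigD1 i0)//= big1 ?addr0. Qed.

Lemma sum_pick_nat a b (j0 : nat) (F : nat -> V) : (a <= j0 < b)%N ->
  (forall j, (a <= j < b)%N -> j != j0 -> F j = 0) ->
    \sum_(a <= j < b) F j = F j0.
Proof.
move=> jab F0; rewrite (bigD1_seq j0) ?mem_index_iota ?iota_uniq//=.
rewrite big_seq_cond big1 ?addr0// => j /andP[]; rewrite mem_index_iota;
  exact: F0.
Qed.

Lemma sum_itv0 a b (F : nat -> V) :
  (forall j, (a <= j < b)%N -> F j = 0) -> \sum_(a <= j < b) F j = 0.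
Proof.
by move=> F0; rewrite big_seq_cond big1// => j; rewrite andbT mem_index_iota;
  exact: F0.
Qed.

End PickTerm.

Lemma card_ord_lt N (i : 'I_N) : #|[set j in [set: 'I_N]%SET | (j < i)%N]%SET| =
  i.
Proof.
rewrite -sum1_card (eq_bigl (fun j : 'I_N => (j < i)%N)) => [|j];
  last by rewrite !inE.
by rewrite -(big_ord_widen N (fun=> 1%N) (ltnW (ltn_ord i))) sum1_card card_ord.
Qed.

Section WedgeTerm.
Context (R : realType) (d : nat) (L : falgType R).
Local Notation N := d.+1.
Local Notation U := 'rV[R]_N.
Local Notation rt := (@row_of_tuple R N).
Variables (S : set U) (f : U -> R).
Hypothesis C1f : C1c S f.

Lemma current_term (c0 k : R) (al be j : 'I_N) (c : L) (w : Defs.form N L) I :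
  (forall x, w I x = (c0 / enorm x ^+ N) *: (k *: (x 0 al *: 1 + x 0 be *: c)))
    ->
  current_of_form w I (partial j f) =
  (c0 * k) *: (moment f al j *: 1 + moment f be j *: c).
Proof.
move=> wE; rewrite /current_of_form.
pose g i (x : U) := c0 * k * (x 0 i * partial j f x / enorm x ^+ N).
have ig i : (lebesgue_tuple N).-integrable setT (fun t => (g i (rt t))%:E).
  apply: (eq_integrable _ _ _ _ (integrableZl _ (c0 * k) (moment_integrable C1f
    i j))) => // t _.
have gE i : \int[lebesgue_tuple N]_t g i (rt t) = c0 * k * moment f i j.
  by rewrite RintegralZl//; exact: (moment_integrable C1f).
rewrite (_ : (fun x => _) = fun x => g al x *: 1 + g be x *: c).
  by rewrite integralL_lincomb// !gE scalerDr !scalerA.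
apply/funext => x; rewrite wE !scalerDr !scalerA /g.
by congr (_ *: _ + _ *: _); ring.
Qed.

(** The sign (-1)^al in Omega and the sign of the wedge product cancel.  The
    cross terms c * moment be al and c * moment al be have opposite signs and
    cancel by symmetry of the moments. *)
Lemma wedge_term (c0 : R) (al be : 'I_N) (c : L) (w : Defs.form N L) :
  (forall x, w [set~ al]%SET x =
     (c0 / enorm x ^+ N) *: ((-1) ^+ al *: (x 0 al *: 1 + x 0 be *: c))) ->
  wedge_dx al (fun I => cr_op c al be (current_of_form w I) f) [set: 'I_N]%SET =
  c0 *: (moment f be be *: c ^+ 2 - moment f al al *: 1).
Proof.
move=> wE; rewrite /wedge_dx finset.in_setT card_ord_lt.
have -> : ([set: 'I_N] :\ al)%SET = [set~ al]%SET by rewrite finset.setTD.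
rewrite /cr_op /dist_partial !(current_term _ wE) (moment_sym C1f be al).
rewrite mulrN opprK -scalerAr mulrDr -!scalerAr mulr1 -expr2.
rewrite -scalerN -scalerDr scalerA mulrCA -expr2 sqrr_sign mulr1;
  congr (_ *: _).
by rewrite opprD -addrA addKr addrC.
Qed.

Lemma current0 (w : Defs.form N L) I (psi : U -> R) : (forall x, w I x = 0) ->
  current_of_form w I psi = 0.
Proof.
move=> w0; rewrite /current_of_form -[RHS](@integralL0 R N L); congr integralL.
by apply/funext => x; rewrite w0 scaler0.
Qed.

End WedgeTerm.

(** * The Cauchy-Riemann operator applied to Omega *)

Section Fundamental.
Context (R : realType) (L : falgType R) (n m p q r d : nat).
Context (e : p.+1.-tuple L) (s : nat -> nat) (a : q.-tuple L).
Local Notation N := d.+1.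
Local Notation U := 'rV[R]_N.
Hypothesis dE : d.+1 = (n * p.+1 + m * q)%N.
Hypothesis e1 : e`_0 = 1.
Hypothesis esum : \sum_(k < p.+1) e`_k ^+ 2 = 0.
Hypothesis s0 : s 0%N = 0%N.
Hypothesis sr : s r = q.
Hypothesis sS : forall k, (k < r)%N -> (s k < s k.+1)%N.
Hypothesis a1 : forall k, (k < r)%N -> a`_(s k) = 1.
Hypothesis asum : forall k, (k < r)%N -> \sum_(s k <= j < s k.+1) a`_j ^+ 2 = 0.

Local Notation Om := (@Omega R L n m p q r d e s a).
Local Notation y := (yco p d).
Local Notation th := (tco n p q d).
Let c0 : R := (N%:R * unit_ball_vol R N)^-1.

Lemma Omega_linform J :
  exists2 V, linform V & Om J = fun x => (c0 / enorm x ^+ N) *: V x.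
Proof.
exists (fun x => (\sum_(i < n) \sum_(1 <= j < p.+1)
        ((-1) ^+ yidx p i j * dx_hat R (y i j) J) *:
          (x 0 (y i j) *: e`_0 + x 0 (y i 0) *: e`_j) +
     \sum_(l < m) \sum_(k < r) \sum_((s k).+1 <= i < s k.+1)
        ((-1) ^+ tidx n p q l i * dx_hat R (th l i) J) *:
          (x 0 (th l i) *: e`_0 + x 0 (th l (s k)) *: a`_i))) => //.
apply: linformD.
  apply: linform_sum => i; apply: linform_sum => j; apply: linformZ.
  by apply: linformD; exact: linform_coord.
apply: linform_sum => l; apply: linform_sum => k; apply: linform_sum => i.
by apply: linformZ; apply: linformD; exact: linform_coord.
Qed.

Lemma dx_hat_setC1 (al be : 'I_N) : dx_hat R al [set~ be]%SET = (be == al)%:R.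
Proof. by rewrite /dx_hat (inj_eq (@finset.setC_inj _)) (inj_eq
  (@finset.set1_inj _)). Qed.

Lemma block_lt k i : (k < r)%N -> (i < s k.+1)%N -> (i < q)%N.
Proof. by move=> kr ik; rewrite (leq_trans ik)// -sr (block_mono sS). Qed.

Lemma Omega_y i j x : (i < n)%N -> (0 < j < p.+1)%N ->
  Om [set~ y i j]%SET x =
  (c0 / enorm x ^+ N) *: ((-1) ^+ y i j *: (x 0 (y i j) *: 1 + x 0 (y i 0) *:
    e`_j)).
Proof.
move=> ni /andP[j0 pj]; rewrite /Omega; congr (_ *: _).
rewrite [X in _ + X]big1 => [|l _]; last first.
  rewrite big1// => k _; apply: sum_itv0 => i' /andP[ki' ik'].
  rewrite dx_hat_setC1; case: eqP => [/(yco_neq_tco dE ni pj (ltn_ord l)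
    (block_lt (ltn_ord k) ik'))//|_].
  by rewrite mulr0 scale0r.
rewrite addr0 (sum_pick_ord (i0 := Ordinal ni)) => [|i' ii']; last first.
  apply: sum_itv0 => j' /andP[_ pj']; rewrite dx_hat_setC1; case: eqP => [h|_].
    have [ii _] := yco_inj dE ni pj (ltn_ord i') pj' h.
    by move: ii'; rewrite -val_eqE /= ii eqxx.
  by rewrite mulr0 scale0r.
rewrite (sum_pick_nat (j0 := j)) ?j0// => [|j' /andP[_ pj'] jj']; last first.
  rewrite dx_hat_setC1; case: eqP => [h|_]; last by rewrite mulr0 scale0r.
  have [_ jj] := yco_inj dE ni pj ni pj' h.
  by move: jj'; rewrite jj eqxx.
by rewrite dx_hat_setC1 eqxx mulr1 e1 (val_yco dE).
Qed.

Lemma Omega_th l k i x : (l < m)%N -> (k < r)%N -> (s k < i < s k.+1)%N ->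
  Om [set~ th l i]%SET x =
  (c0 / enorm x ^+ N) *: ((-1) ^+ th l i *: (x 0 (th l i) *: 1 + x 0 (th l (s
    k)) *: a`_i)).
Proof.
move=> lm kr /andP[ki ik]; rewrite /Omega; congr (_ *: _).
have iq := block_lt kr ik.
rewrite [X in X + _]big1 => [|i' _]; last first.
  apply: sum_itv0 => j' /andP[_ pj']; rewrite dx_hat_setC1.
  case: eqP => [/esym/(yco_neq_tco dE (ltn_ord i') pj' lm iq)//|_].
  by rewrite mulr0 scale0r.
rewrite add0r (sum_pick_ord (i0 := Ordinal lm)) => [|l' ll']; last first.
  rewrite big1// => k' _; apply: sum_itv0 => i' /andP[_ ik'].
  rewrite dx_hat_setC1; case: eqP => [h|_]; last by rewrite mulr0 scale0r.
  have [ll _] := tco_inj dE lm iq (ltn_ord l') (block_lt (ltn_ord k') ik') h.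
  by move: ll'; rewrite -val_eqE /= ll eqxx.
rewrite (sum_pick_ord (i0 := Ordinal kr)) => [|k' kk']; last first.
  apply: sum_itv0 => i' /andP[ki' ik'].
  rewrite dx_hat_setC1; case: eqP => [h|_]; last by rewrite mulr0 scale0r.
  have [_ ii] := tco_inj dE lm iq lm (block_lt (ltn_ord k') ik') h.
  move: kk'; rewrite -val_eqE /= (@block_uniq _ _ sS k k' i) ?eqxx//.
    by rewrite ik ltnW.
  by rewrite ii ik' ltnW.
rewrite (sum_pick_nat (j0 := i)) ?ki// => [|i' /andP[_ ik'] ii']; last first.
  rewrite dx_hat_setC1; case: eqP => [h|_]; last by rewrite mulr0 scale0r.
  have [_ ii] := tco_inj dE lm iq lm (block_lt kr ik') h.
  by move: ii'; rewrite ii eqxx.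
by rewrite dx_hat_setC1 eqxx mulr1 e1 (val_tco dE).
Qed.

(** If J minus al were the complement of a point, that point would be al and J
    would be everything. *)
Lemma Omega_eq0 (al : 'I_N) (J : {set 'I_N}) (x : U) : al \in J ->
  J != [set: 'I_N]%SET -> Om (J :\ al)%SET x = 0.
Proof.
move=> alJ JT.
have hat0 be : dx_hat R be (J :\ al)%SET = 0.
  rewrite /dx_hat; case: eqP => // h; move: JT; rewrite -(finset.setD1K alJ) h.
  have <- : al = be.
    by apply/eqP; move/setP: h => /(_ al); rewrite !inE eqxx => /esym/negbFE.
  by rewrite finset.setUCr eqxx.
rewrite /Omega; rewrite !big1 ?addr0 ?scaler0// => i _.
  by rewrite big1// => k _; apply: sum_itv0 => j _; rewrite hat0 mulr0 scale0r.
by apply: sum_itv0 => j _; rewrite hat0 mulr0 scale0r.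
Qed.

(** Since b u = 1, the squares of the other b j add up to -1, and the surplus
    terms F u add up to the missing diagonal term. *)
Lemma group_sum (u v : nat) (F : nat -> R) (b : nat -> L) : (u < v)%N ->
  b u = 1 ->
  \sum_(u <= j < v) b j ^+ 2 = 0 ->
  \sum_(u.+1 <= j < v) c0 *: (F u *: b j ^+ 2 - F j *: 1) =
  - (c0 * \sum_(u <= j < v) F j) *: 1.
Proof.
move=> uv bu; rewrite !(big_ltn uv) bu expr1n => /eqP;
  rewrite addrC addr_eq0 => /eqP b2.
rewrite -scaler_sumr sumrB -scaler_sumr b2 -scaler_suml scalerN -opprD
  -scalerDl.
by rewrite scalerN scalerA scaleNr.
Qed.

(** Each group contributes minus the sum of its diagonal moments ([wedge_term],
    [group_sum]), and all groups together minus the trace. *)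
Lemma dbar_Omega : current_eq (dbar n m r e s a (current_of_form Om))
  (@eval_origin R N L).
Proof.
move=> J f tf; have C1f := test_function_C1c tf.
(* Only the coefficient of the volume form can be nonzero. *)
rewrite /eval_origin /dbar; case: ifPn => [/eqP ->|JT]; last first.
  have wedge0 al be c : wedge_dx al (fun I => cr_op c al be (current_of_form Om
    I) f) J = 0.
    rewrite /wedge_dx; case: ifPn => // alJ.
    by rewrite /cr_op /dist_partial !current0 ?oppr0 ?mulr0 ?subr0 ?scaler0// =>
      x; exact: Omega_eq0.
  rewrite !big1 ?addr0// => i _; last by apply: sum_itv0 => j _.
  by rewrite big1// => k _; apply: sum_itv0 => j _.
pose F := moment f.
transitivity (\sum_(i < n) - (c0 * \sum_(0 <= j < p.+1) F (y i j) (y i j)) *: (1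
  : L) +
   \sum_(l < m) \sum_(k < r) - (c0 * \sum_(s k <= i < s k.+1) F (th l i) (th l
     i)) *: (1 : L)).
  congr (_ + _); apply: eq_bigr => i _.
    rewrite -(@group_sum 0 p.+1 (fun j => F (y i j) (y i j)) (fun j => e`_j))//.
      rewrite [LHS]big_nat [RHS]big_nat; apply: eq_bigr => j jp.
      by apply: (wedge_term C1f) => x; exact: Omega_y.
    by rewrite big_mkord.
  apply: eq_bigr => k _.
  rewrite -(@group_sum (s k) (s k.+1) (fun j => F (th i j) (th i j)) (fun j =>
    a`_j)) ?sS ?a1 ?asum//.
  rewrite [LHS]big_nat [RHS]big_nat; apply: eq_bigr => j jp.
  by apply: (wedge_term C1f) => x; exact: Omega_th.
under [X in _ + X]eq_bigr do rewrite -scaler_suml sumrN -mulr_sumr (sum_blocks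
  sS) s0 sr.
rewrite -!scaler_suml -scalerDl !sumrN -!mulr_sumr -opprD -mulrDr.
rewrite -(sum_coordinates dE (fun x => F x x)) (moment_trace C1f).
congr (_ *: _); rewrite mulrN opprK mulrA mulVf ?mul1r// mulf_neq0 ?pnatr_eq0//.
by rewrite gt_eqF// unit_ball_vol_gt0.
Qed.

End Fundamental.

Theorem mainTheorem1 (R : realType) (L : falgType R) (L0 L1 : {vspace L})
    (p q r : nat) (e : p.+1.-tuple L) (eps : q.-tuple L) (s : nat -> nat)
    (a : q.-tuple L) (n m d : nat) :
  is_CSA L0 L1 -> condA0 L0 e -> condA1 L0 L1 r eps s a ->
  d.+1 = (n * p.+1 + m * q)%N ->
  fundamental_solution n m r e s a (@Omega R L n m p q r d e s a).
Proof.
move=> _ [_ e1 esum] [_ [s0 sr sS] _ blk] dE; split.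
  by move=> J; have [V lV ->] := @Omega_linform R L n m p q r d e s a J;
    exact: linform_locally_integrable.
apply: (dbar_Omega dE e1 esum s0 sr sS) => k kr; by have [] := blk k kr.
Qed.
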